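(* Let $B\in\mathbb{C}^{N\times N}$ be a non-singular matrix and let $C\in\mathbb{C}^{N\times N}$ be such that $A=B+C$ is non-singular. Let $M_B\in[0,1]$ be given by $$M_B=\sup_{z\in \mathbb{C}^N}\ \sup_{k\in\mathbb{N}}\ \frac{\|r_k^{B,z}\|}{\|r_{k-1}^{B,z}\|},$$ or equivalently, let $M_B\in[0,1]$ be the best possible constant in the inequality $\|r_k^{B,z}\|\le M_B\|r_{k-1}^{B,z}\|$ for all $k\in\mathbb{N}$ and all $z\in\mathbb{C}^N$. If $M_B<1$, then for every $r_0\in\mathbb{C}^N$ $$\frac{\|r_k^{A,r_0}\|}{\|r_0\|}\le\prod_{j=1}^k\Bigl(M_B+(1+M_B)\,\|A^{-1}\|\,\sigma_j(C)\Bigr)\qquad\text{for all }k\in\mathbb{N},$$ and, in particular, $$\left(\frac{\|r_k^{A,r_0}\|}{\|r_0\|}\right)^{1/k}\le M_B+\frac{1}{\sqrt{k}}\,(1+M_B)\,\|A^{-1}\|\,\|C\|_{\mathcal{S}_2}\qquad\text{for all }k\in\mathbb{N},$$ where $\|C\|_{\mathcal{S}_2}$ is the Frobenius norm of $C$.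
   Context: $\|\cdot\|$ denotes the Euclidean norm on $\mathbb{C}^N$ and the induced (spectral) matrix norm; $\mathbb{N}=\{1,2,\dots\}$. $\sigma_1(C)\ge\sigma_2(C)\ge\cdots\ge0$ are the singular values of $C$, with $\sigma_j(C)=0$ for $j>N$. $\mathcal{P}_k$ is the space of complex polynomials of degree at most $k$. GMRES residuals: for $T\in\mathbb{C}^{N\times N}$, an initial residual $r_0\in\mathbb{C}^N$ and $k=0,1,2,\dots$, let $\mathcal{K}_k(T,r_0)=\operatorname{span}\{r_0,Tr_0,\dots,T^{k-1}r_0\}$ (so $\mathcal{K}_0=\{0\}$). The $k$-th GMRES residual $r_k^{T,r_0}$ is the element of minimal norm in the affine space $r_0+T\mathcal{K}_k(T,r_0)$. Thus $r_0^{T,r_0}=r_0$ and $\|r_k^{T,r_0}\|=\min_{p\in\mathcal{P}_k,\,p(0)=1}\|p(T)r_0\|$. Quotients of the form $0/0$ of norms of residuals (which occur once a residual vanishes) are interpreted as $0$. *)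

(* Defs.v *)
From HB Require Import structures.
From mathcomp Require Import all_boot all_order all_algebra.
From mathcomp Require Import spectral.
From mathcomp Require Import complex.
From mathcomp Require Import all_classical all_reals all_analysis.

Set Implicit Arguments.
Unset Strict Implicit.
Unset Printing Implicit Defensive.

Import Order.TTheory GRing.Theory Num.Theory.
Local Open Scope classical_set_scope.
Local Open Scope ring_scope.
Local Open Scope sesquilinear_scope.

(* The canonical norm on matrices in normedtype is the sup norm, hence the
   Euclidean, spectral and Frobenius norms below. The complex numbers are R[i]
   for R : realType, and all norms take their values in R. *)

Definition l2norm (R : realType) (N : nat) (x : 'cV[R[i]]_N) : R :=
  Num.sqrt (\sum_(i < N) Normc.normc (x i 0) ^+ 2).

Definition opnorm (R : realType) (N : nat) (T : 'M[R[i]]_N) : R :=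
  sup [set l2norm (T *m x) | x in [set x : 'cV[R[i]]_N | l2norm x <= 1]].

Definition frobenius_norm (R : realType) (N : nat) (T : 'M[R[i]]_N) : R :=
  Num.sqrt (\sum_(i < N) \sum_(j < N) Normc.normc (T i j) ^+ 2).

(* Square roots of the eigenvalues of T^* T, with multiplicity, in
   non-increasing order. T^* T is Hermitian, so that spectral_diag does list
   its eigenvalues, which are real and non-negative. *)
Definition singular_values (R : realType) (N : nat) (T : 'M[R[i]]_N) : seq R :=
  sort >=%R
    [seq Num.sqrt (complex.Re (spectral_diag (T ^t* *m T) 0 i)) | i <- enum 'I_N].

(* Indexed from 1; 0 for j > N. *)
Definition singular_value (R : realType) (N : nat) (T : 'M[R[i]]_N) (j : nat) : R :=
  nth 0 (singular_values T) j.-1.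

Definition krylov (R : realType) (N : nat) (T : 'M[R[i]]_N) (r0 : 'cV[R[i]]_N)
    (k : nat) : {vspace 'cV[R[i]]_N} :=
  <<[seq T ^+ i *m r0 | i <- iota 0 k]>>%VS.

Definition gmres_affine (R : realType) (N : nat) (T : 'M[R[i]]_N)
    (r0 : 'cV[R[i]]_N) (k : nat) : set 'cV[R[i]]_N :=
  [set r0 + T *m y | y in [set y | y \in krylov T r0 k]].

(* The minimizer exists and is unique, so the default value r0 of xget plays no
   role. *)
Definition gmres_residual (R : realType) (N : nat) (T : 'M[R[i]]_N)
    (r0 : 'cV[R[i]]_N) (k : nat) : 'cV[R[i]]_N :=
  xget r0 [set r | gmres_affine T r0 k r /\
                   forall s, gmres_affine T r0 k s -> l2norm r <= l2norm s].

(* The convention 0 / 0 = 0 is that of division in a field of MathComp. The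
   quotients lie in [0, 1], so both suprema are those of non-empty bounded sets. *)
Definition gmres_rate (R : realType) (N : nat) (B : 'M[R[i]]_N) : R :=
  sup [set sup [set l2norm (gmres_residual B z k) /
                    l2norm (gmres_residual B z k.-1) | k in [set k | (0 < k)%N]]
      | z in [set: 'cV[R[i]]_N]].

(* Main.v *)
Require Import Defs.
From HB Require Import structures.
From mathcomp Require Import all_boot all_order all_algebra.
From mathcomp Require Import spectral.
From mathcomp Require Import complex.
From mathcomp Require Import all_classical all_reals all_analysis.
From mathcomp Require polyrcf.
From mathcomp Require Import ring lra.

(** Write M for the rate of B, sigma_j for the singular values of C, and
    beta_j = M + (1 + M) |A^-1| sigma_j. The core is the inequality
    |r_k| <= beta_1 ... beta_k |r_0|; the second bound follows from it by the
    inequality between geometric and arithmetic means and by Cauchy-Schwarz,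
    since the squares of the sigma_j sum up to the squared Frobenius norm of C.

    Only the first step of GMRES for B is used. It says that every vector z
    is approximated up to M |z| by a multiple of B z, a statement about the
    angle between z and B z, so that it holds for B^-1 as well: for each z there
    is c with |z - c B^-1 z| <= M |z|. The decisive point is that, up to an
    arbitrarily small loss, the same c serves for all z
    ([ideal_of_worst_case_degree1]): for polynomials of degree one, worst case
    and ideal GMRES coincide. Take x for which the cosine of the angle between x
    and T x is nearly least, T = B^-1, and let c be the best multiplier for x.
    Given z, [merge_two_vectors] produces a vector w whose values of |w|^2 and
    of the form (w, T w) are the sums of those for x and for a small multiple
    of z, while |T w|^2 is at least the sum; comparing the cosines for w and x to
    first order in the size of the multiple gives the bound for z.

    With E = 1 - c B^-1 one has 1 - c A^-1 = E + (1 - E) C A^-1. Hence on the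
    space of codimension at most j - 1 where A^-1 x is orthogonal to the leading
    right singular vectors of C, the norm of F x = (1 - c A^-1) x is at most
    beta_j |x|.

    It remains to show that such bounds on F multiply up. Let X have the columns
    A r_0, ..., A^k r_0 and let Q be the orthogonal projection onto the
    complement of r_0. Two expansions of the Gram determinant of r_0 and X give
    |r_k|^2 det(X' X) = |r_0|^2 det((Q X)' (Q X)), with ' for the adjoint
    ([residual_gram_ratio]). Since Q r_0 = 0, replacing each column A^j r_0 by
    A^j r_0 - c A^(j-1) r_0, that is X by F X, is a unimodular column operation
    on Q X ([det_gram_krylov_shift]). So |r_k|^2 / |r_0|^2 is the factor by
    which Q F changes the Gram determinant of X, and this is at most the product
    of the squares of the beta_j by a dimension count for each eigenvalue
    ([det_gram_le]). *)

Set Implicit Arguments.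
Unset Strict Implicit.
Unset Printing Implicit Defensive.

Import Order.TTheory GRing.Theory Num.Theory.
Local Open Scope ring_scope.
Local Open Scope sesquilinear_scope.
Local Open Scope complex_scope.

(** * Hermitian inner product on column vectors *)

Section InnerProduct.
Variable R : rcfType.

Lemma normc_sqr (a : R[i]) : Normc.normc a ^+ 2 = complex.Re a ^+ 2 + complex.Im a ^+ 2.
Proof. by case: a => c d /=; rewrite sqr_sqrtr // addr_ge0 ?sqr_ge0. Qed.

Lemma normcJ (a : R[i]) : Normc.normc (a^*)%R = Normc.normc a.
Proof. by case: a => c d /=; rewrite sqrrN. Qed.

Lemma normc_real_sqr (a : R) : Normc.normc a%:C ^+ 2 = a ^+ 2.
Proof. by rewrite normc_sqr /= expr0n addr0. Qed.

Lemma conjC_real_complex (x : R) : (((x%:C)%C)^*)%R = x%:C.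
Proof. exact: conjc_real. Qed.

Lemma Re_realM (a : R) (z : R[i]) : complex.Re (a%:C * z) = a * complex.Re z.
Proof. by case: z => c d /=; rewrite mul0r subr0. Qed.

Lemma conj_mul_normc (a : R[i]) : (a^*)%R * a = (Normc.normc a ^+ 2)%:C.
Proof.
case: a => a b; rewrite /Normc.normc sqr_sqrtr ?addr_ge0 ?sqr_ge0 //.
by apply/eqP; rewrite eq_complex /=; apply/andP; split; apply/eqP; ring.
Qed.

Definition vdot n (x y : 'cV[R[i]]_n) : R[i] := (x^t* *m y) 0 0.
Definition normsq n (x : 'cV[R[i]]_n) : R := complex.Re (vdot x x).

Lemma vdotDl n (x y z : 'cV[R[i]]_n) : vdot (x + y) z = vdot x z + vdot y z.
Proof. by rewrite /vdot linearD map_mxD mulmxDl mxE. Qed.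

Lemma vdotDr n (x y z : 'cV[R[i]]_n) : vdot x (y + z) = vdot x y + vdot x z.
Proof. by rewrite /vdot mulmxDr mxE. Qed.

Lemma vdotZl n a (x y : 'cV[R[i]]_n) : vdot (a *: x) y = (a^*)%R * vdot x y.
Proof. by rewrite /vdot linearZ map_mxZ -scalemxAl mxE. Qed.

Lemma vdotZr n a (x y : 'cV[R[i]]_n) : vdot x (a *: y) = a * vdot x y.
Proof. by rewrite /vdot -scalemxAr mxE. Qed.

Lemma vdotC n (x y : 'cV[R[i]]_n) : vdot y x = (vdot x y)^*%R.
Proof.
rewrite /vdot !mxE rmorph_sum; apply: eq_bigr => i _.
by rewrite !mxE rmorphM /= conjCK mulrC.
Qed.

Lemma normsq_sum n (x : 'cV[R[i]]_n) :
  normsq x = \sum_(i < n) Normc.normc (x i 0) ^+ 2.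
Proof.
rewrite /normsq /vdot mxE raddf_sum /=.
by apply: eq_bigr => i _; rewrite !mxE conj_mul_normc.
Qed.

Lemma vdotxx n (x : 'cV[R[i]]_n) : vdot x x = (normsq x)%:C.
Proof.
rewrite normsq_sum /vdot mxE rmorph_sum /=.
by apply: eq_bigr => i _; rewrite !mxE conj_mul_normc.
Qed.

Lemma normsq_ge0 n (x : 'cV[R[i]]_n) : 0 <= normsq x.
Proof. by rewrite normsq_sum sumr_ge0 // => i _; rewrite sqr_ge0. Qed.

Lemma normsq_eq0 n (x : 'cV[R[i]]_n) : (normsq x == 0) = (x == 0).
Proof.
apply/eqP/eqP => [|->]; last first.
  by rewrite normsq_sum big1 // => i _; rewrite mxE Normc.normc0 expr0n.
rewrite normsq_sum => /eqP; rewrite psumr_eq0; last by move=> i _; rewrite sqr_ge0.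
move=> /allP h; apply/matrixP => i j; rewrite (ord1 j) mxE.
have := h i (mem_index_enum _); rewrite sqrf_eq0 => /eqP.
exact: Normc.eq0_normc.
Qed.

Lemma normsq0 n : normsq (0 : 'cV[R[i]]_n) = 0.
Proof. by apply/eqP; rewrite normsq_eq0. Qed.

Lemma normsq_gt0 n (x : 'cV[R[i]]_n) : (0 < normsq x) = (x != 0).
Proof. by rewrite lt_def normsq_ge0 andbT normsq_eq0. Qed.

Lemma normsqZ n a (x : 'cV[R[i]]_n) : normsq (a *: x) = Normc.normc a ^+ 2 * normsq x.
Proof.
apply: complexI; rewrite -vdotxx vdotZl vdotZr mulrA conj_mul_normc vdotxx.
by rewrite -rmorphM.
Qed.

Lemma normsqZr n (a : R) (x : 'cV[R[i]]_n) : normsq (a%:C *: x) = a ^+ 2 * normsq x.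
Proof. by rewrite normsqZ normc_real_sqr. Qed.

Lemma normsqD n (x y : 'cV[R[i]]_n) :
  normsq (x + y) = normsq x + normsq y + 2 * complex.Re (vdot x y).
Proof.
rewrite /normsq vdotDl !vdotDr (vdotC x y) !raddfD /=.
by case: (vdot x y) => a b /=; ring.
Qed.

Lemma adjmxM m n p (A : 'M[R[i]]_(m, n)) (B : 'M[R[i]]_(n, p)) :
  (A *m B)^t* = B^t* *m A^t*.
Proof. by rewrite trmx_mul map_mxM. Qed.

Lemma vdot_mul m n (A : 'M[R[i]]_(m, n)) x y :
  vdot (A *m x) y = vdot x (A^t* *m y).
Proof. by rewrite /vdot adjmxM mulmxA. Qed.

Lemma normsqB n (x y : 'cV[R[i]]_n) :
  normsq (x - y) = normsq x + normsq y - 2 * complex.Re (vdot x y).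
Proof.
rewrite normsqD -scaleN1r normsqZ normc_sqr /= oppr0 sqrrN expr1n expr0n addr0 mul1r vdotZr.
by rewrite mulN1r raddfN mulrN.
Qed.

Lemma vdotZZ n (a : R) (x y : 'cV[R[i]]_n) :
  vdot (a%:C *: x) (a%:C *: y) = (a ^+ 2)%:C * vdot x y.
Proof. by rewrite vdotZl vdotZr mulrA conj_mul_normc normc_real_sqr. Qed.

Lemma cauchy_schwarz n (x y : 'cV[R[i]]_n) :
  Normc.normc (vdot x y) ^+ 2 <= normsq x * normsq y.
Proof.
have [->|y0] := eqVneq y 0.
  by rewrite /vdot mulmx0 mxE Normc.normc0 expr0n /= mulr_ge0 ?normsq_ge0.
have ny : 0 < normsq y by rewrite normsq_gt0.
have := normsq_ge0 (x - ((normsq y)^-1%:C * vdot y x) *: y).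
rewrite normsqB normsqZ vdotZr Normc.normcM exprMn (vdotC x y) normcJ.
set b := vdot x y.
have -> : complex.Re ((normsq y)^-1%:C * (b^*)%R * b) = (normsq y)^-1 * Normc.normc b ^+ 2.
  by rewrite -mulrA conj_mul_normc -rmorphM.
rewrite normc_real_sqr.
set N := Normc.normc b ^+ 2.
have -> : normsq x + (normsq y)^-1 ^+ 2 * N * normsq y - 2 * ((normsq y)^-1 * N) =
  (normsq x * normsq y - N) / normsq y by field; rewrite gt_eqF.
by rewrite pmulr_lge0 ?invr_gt0 // subr_ge0.
Qed.

End InnerProduct.

(** * Merging two vectors into one *)

Section TwoVectors.
Variable R : rcfType.

(** Dimension counts below all take the form: fewer linear conditions than
    unknowns. *)
Lemma exists_nonzero_kernel (F : fieldType) m n (Z : 'M[F]_(m, n)) : (m < n)%N ->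
  exists2 x : 'cV[F]_n, x != 0 & Z *m x = 0.
Proof.
move=> mn; have : kermx Z^T != 0.
  rewrite kermx_eq0 /row_free mxrank_tr neq_ltn.
  by rewrite (leq_ltn_trans (rank_leq_row Z)).
move=> /rowV0Pn [v vk v0]; exists v^T; first by rewrite trmx_eq0.
by apply: trmx_inj; rewrite trmx_mul trmxK trmx0; apply/sub_kermxP.
Qed.

(** For the Hermitian 2 x 2 matrix H with diagonal p, q and off-diagonal entry of
    squared modulus W, of negative determinant: scaling H until its least eigenvalue
    is -1 makes 1 + t H positive semidefinite of determinant zero. Here s is
    minus the least eigenvalue of H, and t is its inverse. *)
Lemma rank_one_scaling_pos (p q W : R) : 0 <= W -> p * q < W ->
  exists t, [/\ 0 < t, 0 <= 1 + t * p, 0 <= 1 + t * q &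
    (1 + t * p) * (1 + t * q) = t ^+ 2 * W].
Proof.
move=> W0 pqW.
pose S := Num.sqrt ((p - q) ^+ 2 + 4 * W).
have S2 : S ^+ 2 = (p - q) ^+ 2 + 4 * W.
  by rewrite sqr_sqrtr // addr_ge0 ?sqr_ge0 // mulr_ge0.
have S0 : 0 <= S by exact: sqrtr_ge0.
have hS x : x ^+ 2 <= S ^+ 2 -> - S <= x <= S.
  move=> h; rewrite -ler_norml -(@ler_pXn2r _ 2) ?nnegrE //.
  by rewrite real_normK ?num_real.
have hS' x : x ^+ 2 < S ^+ 2 -> - S < x < S.
  move=> h; rewrite -ltr_norml -(@ltr_pXn2r _ 2) ?nnegrE //.
  by rewrite real_normK ?num_real.
have /andP[h1 h2] : - S <= p - q <= S by apply: hS; rewrite S2; lra.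
have /andP[h3 h4] : - S < p + q < S.
  apply: hS'; rewrite S2; suff : (p + q) ^+ 2 = (p - q) ^+ 2 + 4 * (p * q) by lra.
  by ring.
pose s := (S - (p + q)) / 2.
have s0 : 0 < s by rewrite /s; lra.
have sp : s + p = (S + (p - q)) / 2 by rewrite /s; field.
have sq : s + q = (S - (p - q)) / 2 by rewrite /s; field.
exists s^-1; split; first by rewrite invr_gt0.
- have -> : 1 + s^-1 * p = s^-1 * (s + p) by field; rewrite gt_eqF.
  by rewrite mulr_ge0 ?invr_ge0 ?(ltW s0) // sp; lra.
- have -> : 1 + s^-1 * q = s^-1 * (s + q) by field; rewrite gt_eqF.
  by rewrite mulr_ge0 ?invr_ge0 ?(ltW s0) // sq; lra.
have -> : W = (s + p) * (s + q).
  have h : 4 * W = S ^+ 2 - (p - q) ^+ 2 by rewrite S2; ring.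
  have -> : W = (S ^+ 2 - (p - q) ^+ 2) / 4 by rewrite -h; field.
  by rewrite sp sq; field.
by field; rewrite gt_eqF.
Qed.

(** An indefinite H can be scaled in both directions, so the sign of t can be
    prescribed. *)
Lemma rank_one_scaling (p q W g : R) : 0 <= W -> p * q < W ->
  exists t, [/\ 0 <= t * g, 0 <= 1 + t * p, 0 <= 1 + t * q &
    (1 + t * p) * (1 + t * q) = t ^+ 2 * W].
Proof.
move=> W0 pqW; have [g0|g0] := leP 0 g.
  by have [t [t0 h1 h2 h3]] := rank_one_scaling_pos W0 pqW; exists t; split => //;
    rewrite mulr_ge0 // ltW.
have [|t [t0 h1 h2 h3]] := @rank_one_scaling_pos (- p) (- q) W W0; first by rewrite mulrNN.
by exists (- t); split; rewrite ?mulNr -?mulrN // ?sqrrN // mulr_ge0 ?ltW ?oppr_gt0.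
Qed.

(** A positive semidefinite Hermitian 2 x 2 matrix of determinant zero has rank
    one: it is the matrix of products of the coordinates of one vector (a, b). *)
Lemma rank_one_coefs (P Q : R) (u : R[i]) : 0 <= P -> 0 <= Q ->
  P * Q = Normc.normc u ^+ 2 ->
  exists a b : R[i], [/\ a^* * a = P%:C, b^* * b = Q%:C & b^* * a = u]%R.
Proof.
move=> P0 Q0 PQ; have [P00|Pn0] := eqVneq P 0.
  exists 0, (Num.sqrt Q)%:C; rewrite !mulr0 P00 conj_mul_normc /= expr0n addr0.
  rewrite (sqr_sqrtr (sqr_ge0 _)) sqr_sqrtr //; split => //.
  apply/esym/Normc.eq0_normc/eqP; rewrite -sqrf_eq0.
  by rewrite -PQ P00 mul0r.
have sP : Num.sqrt P != 0 by rewrite sqrtr_eq0 -ltNge lt_def Pn0.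
exists (Num.sqrt P)%:C, ((u^*)%R / (Num.sqrt P)%:C).
rewrite !conj_mul_normc /= expr0n addr0 (sqr_sqrtr (sqr_ge0 _)) sqr_sqrtr //; split => //.
- congr (_%:C); apply: (mulfI Pn0); rewrite PQ.
  rewrite Normc.normcM exprMn Normc.normcV exprVn /= expr0n addr0.
  rewrite (sqr_sqrtr (sqr_ge0 _)) sqr_sqrtr // mulrCA mulfV // mulr1.
  by case: (u) => c d /=; rewrite sqrrN.
- rewrite rmorphM /= conjCK fmorphV /= conjC_real_complex -mulrA mulVf ?mulr1 //.
  by apply: contra sP => /eqP [->].
Qed.

Lemma sesqui_expand n (P Q : 'M[R[i]]_n) x y (a b : R[i]) :
  let f u v := vdot (P *m u) (Q *m v) in
  f (a *: x + b *: y) (a *: x + b *: y) =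
  (a^* * a * f x x + b^* * b * f y y + b^* * a * f y x + (b^* * a)^* * f x y)%R.
Proof.
rewrite /= !mulmxDr -!scalemxAr vdotDl !vdotDr !vdotZl !vdotZr rmorphM /= conjCK.
by ring.
Qed.

(** The values of the three forms at a x + b y depend linearly on the Hermitian
    rank one matrix K of the products of the coordinates a, b, and the sums of the
    values at x and y belong to K = 1. The Hermitian 2 x 2 matrices have real
    dimension four and the two equations amount to three real ones, so there is a
    line 1 + t H through 1 on which they persist. As the norm is definite, H is
    indefinite when x and y are independent, and the line leaves the positive
    semidefinite cone in both directions, at matrices of rank one; one of the two
    directions does not decrease the third form. In the classical proof that worst
    case and ideal GMRES agree in degree one, convexity of the numerical range plays
    this role. *)
Lemma merge_two_vectors n (T : 'M[R[i]]_n) (x y : 'cV[R[i]]_n) :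
  exists z, [/\ normsq z = normsq x + normsq y,
    vdot z (T *m z) = vdot x (T *m x) + vdot y (T *m y) &
    normsq (T *m x) + normsq (T *m y) <= normsq (T *m z)].
Proof.
have [y0|y0] := eqVneq y 0.
  by exists x; rewrite y0 mulmx0 vdotxx normsq0 !addr0; split.
have [xy|xy] := eqVneq x ((vdot y x / vdot y y) *: y).
  set l := _ / _ in xy; exists ((Num.sqrt (Normc.normc l ^+ 2 + 1))%:C *: y).
  have h : Num.sqrt (Normc.normc l ^+ 2 + 1) ^+ 2 = Normc.normc l ^+ 2 + 1.
    by rewrite sqr_sqrtr // addr_ge0 ?sqr_ge0.
  rewrite -scalemxAr !normsqZr !h [in normsq x]xy [in T *m x]xy -scalemxAr !normsqZ.
  split; [by ring| |by rewrite mulrDl mul1r].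
  rewrite vdotZl vdotZr mulrA conj_mul_normc /= expr0n addr0 (sqr_sqrtr (sqr_ge0 _)) h.
  rewrite {1}xy vdotZl vdotZr mulrA conj_mul_normc rmorphD /= rmorph1.
  by rewrite mulrDl mul1r.
have indep (a b : R[i]) : a *: x + b *: y = 0 -> a = 0 /\ b = 0.
  move=> h; have a0 : a = 0.
    apply/eqP/negPn/negP => a0; move/eqP: xy; apply.
    have hx : x = - (b / a) *: y.
      apply: (scalerI a0); rewrite scalerA mulrN mulrCA mulfV // mulr1 scaleNr.
      by apply/eqP; rewrite -addr_eq0 h.
    rewrite {2}hx vdotZr mulfK // vdotxx.
    by apply/eqP => -[]/eqP; rewrite normsq_eq0 (negPf y0).
  split=> //; move/eqP: h; rewrite a0 scale0r add0r scaler_eq0 (negPf y0) orbF.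
  by move/eqP.
(* coef f lists the coefficients of p, q, w1, w2 in the change of the form f
   when the Gram matrix of coordinates moves along H = [p, w; conj w, q]. *)
pose coef (f : 'cV[R[i]]_n -> 'cV[R[i]]_n -> R[i]) (l : 'I_4) : R[i] :=
  [:: f x x; f y y; f y x + f x y; 'i%C * (f y x - f x y)]`_l.
pose N (u v : 'cV[R[i]]_n) := vdot (1%:M *m u) (1%:M *m v).
pose W (u v : 'cV[R[i]]_n) := vdot (1%:M *m u) (T *m v).
pose G (u v : 'cV[R[i]]_n) := vdot (T *m u) (T *m v).
pose Z : 'M[R]_(3, 4) := \matrix_(i, l)
  [:: complex.Re (coef N l); complex.Re (coef W l); complex.Im (coef W l)]`_i.
have [v v0 Zv] := @exists_nonzero_kernel R 3 4 Z isT.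
have Zi (i : 'I_3) : \sum_l Z i l * v l 0 = 0.
  by have := congr1 (fun A : 'cV_3 => A i 0) Zv; rewrite !mxE.
pose p := v 0 0; pose q := v 1 0; pose w1 := v 2%:R 0; pose w2 := v 3%:R 0.
pose w := w1 +i* w2.
pose E f := p%:C * f x x + q%:C * f y y + w * f y x + (w^*)%R * f x y.
have E_linear f : E f = \sum_(l < 4) (v l 0)%:C * coef f l.
  rewrite /E !big_ord_recl big_ord0 /coef /= /p /q /w /w1 /w2.
  have -> : lift ord0 (lift ord0 (ord0 : 'I_2)) = 2%:R :> 'I_4 by apply: val_inj.
  have -> : lift ord0 (lift ord0 (lift ord0 (ord0 : 'I_1))) = 3%:R :> 'I_4 by apply: val_inj.
  have -> : lift ord0 (ord0 : 'I_3) = 1 :> 'I_4 by apply: val_inj.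
  rewrite [v 2%:R 0 +i* v 3%:R 0]complexE /= rmorphD rmorphM /= !conjC_real_complex.
  have -> : (('i%C : R[i])^*)%R = - 'i%C by exact: conjCi.
  by ring.
have ReE f : complex.Re (E f) = \sum_(l < 4) v l 0 * complex.Re (coef f l).
  rewrite E_linear raddf_sum; apply: eq_bigr => l _.
  by case: (coef f l) => c d /=; ring.
have ImE f : complex.Im (E f) = \sum_(l < 4) v l 0 * complex.Im (coef f l).
  rewrite E_linear raddf_sum; apply: eq_bigr => l _.
  by case: (coef f l) => c d /=; ring.
have EN0 : complex.Re (E N) = 0.
  rewrite -[RHS](Zi 0) ReE; apply: eq_bigr => l _.
  by rewrite mxE mulrC.
have EW0 : E W = 0.
  apply/eqP; rewrite eq_complex; apply/andP; split; apply/eqP.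
  - rewrite -[RHS](Zi 1) ReE; apply: eq_bigr => l _.
    by rewrite mxE mulrC.
  - rewrite -[RHS](Zi 2%:R) ImE; apply: eq_bigr => l _.
    by rewrite mxE mulrC.
have Nq : complex.Re (E N) = p * normsq x + q * normsq y + 2 * complex.Re (w * vdot y x).
  rewrite /E /N !mul1mx !vdotxx (vdotC y x).
  by case: (vdot y x) => c d; rewrite /= /w /=; ring.
pose W2 := Normc.normc w ^+ 2.
have W20 : 0 <= W2 by exact: sqr_ge0.
have hx : normsq (p%:C *: x + (w^*)%R *: y) + (p * q - W2) * normsq y = 0.
  transitivity (p * complex.Re (E N)); last by rewrite EN0 mulr0.
  rewrite Nq normsqD normsqZr normsqZ vdotZl vdotZr conjC_real_complex (vdotC y x).
  by rewrite normcJ -/W2 /w; case: (vdot y x) => c d /=; ring.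
have hy : normsq (w *: x + q%:C *: y) + (p * q - W2) * normsq x = 0.
  transitivity (q * complex.Re (E N)); last by rewrite EN0 mulr0.
  rewrite Nq normsqD normsqZr normsqZ vdotZl vdotZr (vdotC y x).
  by rewrite -/W2 /w; case: (vdot y x) => c d /=; ring.
(* H is indefinite: the equation for the norm excludes that it is semidefinite
   and nonzero. *)
have pqW : p * q < W2.
  rewrite ltNge; apply/negP => le; rewrite -subr_ge0 in le.
  have z1 : p%:C *: x + (w^*)%R *: y = 0.
    apply/eqP; rewrite -normsq_eq0; move/eqP: hx.
    by rewrite paddr_eq0 ?normsq_ge0 ?mulr_ge0 ?normsq_ge0 // => /andP[].
  have z2 : w *: x + q%:C *: y = 0.
    apply/eqP; rewrite -normsq_eq0; move/eqP: hy.
    by rewrite paddr_eq0 ?normsq_ge0 ?mulr_ge0 ?normsq_ge0 // => /andP[].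
  have [[p0] _] := indep _ _ z1.
  have [[w10 w20] [q0]] := indep _ _ z2.
  move/eqP: v0; apply; apply/matrixP => l j; rewrite (ord1 j) mxE.
  case: l => -[|[|[|[|//]]]] hl.
  - by rewrite -[RHS]p0; congr (v _ _); apply: val_inj.
  - by rewrite -[RHS]q0; congr (v _ _); apply: val_inj.
  - by rewrite -[RHS]w10; congr (v _ _); apply: val_inj.
  - by rewrite -[RHS]w20; congr (v _ _); apply: val_inj.
have [t [tg P0 Q0 PQ]] := rank_one_scaling (complex.Re (E G)) W20 pqW.
have [|a [b [ha hb hab]]] := @rank_one_coefs _ _ (t%:C * w) P0 Q0.
  by rewrite PQ Normc.normcM exprMn normc_real_sqr.
have key (P Q : 'M[R[i]]_n) f : f = (fun u v => vdot (P *m u) (Q *m v)) ->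
    f (a *: x + b *: y) (a *: x + b *: y) = f x x + f y y + t%:C * E f.
  move=> ->; rewrite sesqui_expand ha hb hab /E !rmorphD !rmorphM /= rmorph1.
  by rewrite conjC_real_complex; ring.
exists (a *: x + b *: y); split.
- have := congr1 (@complex.Re R) (key 1%:M 1%:M N erefl).
  rewrite /N !mul1mx !vdotxx /= => ->; move: EN0; case: (E N) => c d /= ->.
  by rewrite !mulr0 mul0r subr0 addr0.
- by have := key 1%:M T W erefl; rewrite /W !mul1mx EW0 mulr0 addr0.
- have := congr1 (@complex.Re R) (key T T G erefl).
  rewrite /G !vdotxx /= -/G => ->; move: tg; case: (E G) => c d /=.
  by rewrite mul0r subr0 lerDl.
Qed.
End TwoVectors.

(** * Polynomials of degree one: worst case and ideal case agree *)

Section Minimax.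
Variable R : realType.

(** The computation behind the next lemma. For a nearly worst vector x of norm
    one: gs = |T x|^2, B = |(x, T x)|^2; for an arbitrary z: nu = |z|^2, g = |T z|^2,
    and r is the real part of conj (x, T x) (z, T z). The hypothesis with k compares
    cosines after adding t0 / nu times the data of z to those of x; the terms of
    order zero cancel up to eps, those of order one give the claim, and eta absorbs
    the rest. The left-hand side is |z - c T z|^2 for c = conj (x, T x) / gs. *)
Lemma first_order_step (k eps t0 l L eta nu g gs B r : R) :
  0 < t0 -> 0 <= k -> 0 < gs -> 0 < nu -> 0 <= g -> 0 <= eps ->
  B <= (k + eps) * gs ->
  k * ((1 + t0 / nu * nu) * (gs + t0 / nu * g)) <=
    B + 2 * (t0 / nu) * r + (t0 / nu) ^+ 2 * (nu * g) ->
  g <= L * nu -> l <= gs -> 0 < l ->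
  eps / t0 + (t0 + eps) * L / l <= eta -> 0 <= L ->
  nu - 2 * (r / gs) + B / gs ^+ 2 * g <= (1 - k + eta) * nu.
Proof.
move=> t00 k0 gs0 nu0 g0 eps0 hB h hg hl l0 heta L0.
set t := t0 / nu in h.
have tp : 0 < t by rewrite divr_gt0.
have tnu : t * nu = t0 by rewrite /t mulfVK // gt_eqF.
clearbody t.
have h1 : k * t * (g + nu * gs) <= eps * gs + 2 * t * r + t * t0 * g.
  have e : k * ((1 + t * nu) * (gs + t * g)) =
    k * t * (g + nu * gs) + k * gs + k * t0 * t * g by rewrite -tnu; ring.
  have e2 : t ^+ 2 * (nu * g) = t * t0 * g by rewrite -tnu; ring.
  have e3 : 0 <= k * t0 * t * g by rewrite !mulr_ge0 ?(ltW t00) ?(ltW tp).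
  by rewrite e e2 in h; move: hB; rewrite mulrDl; lra.
have h2 : k * (g + nu * gs) <= eps * gs * nu / t0 + 2 * r + t0 * g.
  rewrite -(ler_pM2l tp).
  have -> : t * (eps * gs * nu / t0 + 2 * r + t0 * g) = eps * gs + 2 * t * r + t * t0 * g.
    by rewrite -tnu; field; rewrite !gt_eqF.
  by rewrite mulrA (mulrC t).
have h3 : B / gs ^+ 2 * g <= (k + eps) * g / gs.
  have -> : B / gs ^+ 2 * g = (B / gs) * (g / gs) by field; rewrite gt_eqF.
  rewrite -(mulrA (k + eps)) ler_wpM2r ?divr_ge0 ?(ltW gs0) //.
  by rewrite ler_pdivrMr.
have h4 : (t0 + eps) * g <= (t0 + eps) * L / l * nu * gs.
  have : (t0 + eps) * g <= (t0 + eps) * (L * nu) by rewrite ler_wpM2l // addr_ge0 // ltW.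
  move=> /le_trans; apply.
  have -> : (t0 + eps) * L / l * nu * gs = (t0 + eps) * (L * nu) * (gs / l).
    by field; rewrite gt_eqF.
  rewrite ler_peMr ?mulr_ge0 ?addr_ge0 ?(ltW t00) ?(ltW nu0) //.
  by rewrite ler_pdivlMr // mul1r.
have h5 : eps / t0 * nu * gs + (t0 + eps) * L / l * nu * gs <= eta * nu * gs.
  by rewrite -mulrDl -mulrDl ler_pM2r // ler_pM2r.
have h6 : eps * gs * nu / t0 = eps / t0 * nu * gs by field; rewrite gt_eqF.
rewrite -(ler_pM2r gs0).
have e1 : (nu - 2 * (r / gs) + B / gs ^+ 2 * g) * gs =
   nu * gs - 2 * r + (B / gs ^+ 2 * g) * gs by field; rewrite gt_eqF.
have h7 : (B / gs ^+ 2 * g) * gs <= (k + eps) * g by rewrite -ler_pdivlMr.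
by rewrite e1; move: h2 h4 h5; rewrite h6 !mulrDl !mulrDr; move: h7; rewrite mulrDl; lra.
Qed.

(** The least squared cosine k of the angle between z and T z need not be shown
    to be attained: a vector within eps of it, with eps small against eta, is enough.
    The bounds l and L on T keep the error uniform in z. *)
Lemma ideal_of_worst_case_degree1 n (T : 'M[R[i]]_n) (s2 l L : R) :
  0 <= s2 -> 0 < l -> 0 < L ->
  (forall z, l * normsq z <= normsq (T *m z)) ->
  (forall z, normsq (T *m z) <= L * normsq z) ->
  (forall z, s2 * (normsq z * normsq (T *m z)) <= Normc.normc (vdot z (T *m z)) ^+ 2) ->
  forall eta, 0 < eta -> exists c : R[i], forall z,
    normsq (z - c *: (T *m z)) <= (1 - s2 + eta) * normsq z.
Proof.
move=> s20 l0 L0 hl hL hs eta eta0.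
pose S := [set Normc.normc (vdot z (T *m z)) ^+ 2 / normsq (T *m z) |
  z in [set z : 'cV[R[i]]_n | normsq z = 1]]%classic.
have [[x0 x01]|noz] := pselect (exists x : 'cV[R[i]]_n, normsq x = 1); last first.
  exists 0 => z; rewrite scale0r subr0.
  have -> : normsq z = 0; last by rewrite mulr0.
  apply/eqP/negPn/negP => z0; apply: noz.
  exists ((Num.sqrt (normsq z)^-1)%:C *: z).
  by rewrite normsqZr sqr_sqrtr ?mulVf // invr_ge0 normsq_ge0.
have Tpos z : normsq z = 1 -> 0 < normsq (T *m z).
  by move=> z1; apply: lt_le_trans (hl z); rewrite z1 mulr1.
have lbS : lbound S s2.
  move=> _ [z /= z1 <-]; rewrite ler_pdivlMr ?Tpos //.
  by have := hs z; rewrite z1 mul1r.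
have infS : has_inf S.
  by split; [exists (Normc.normc (vdot x0 (T *m x0)) ^+ 2 / normsq (T *m x0)), x0|exists s2].
pose k := inf S.
have sk : s2 <= k by apply: lb_le_inf => //; case: infS.
have k0 : 0 <= k by exact: le_trans sk.
have hk w : k * (normsq w * normsq (T *m w)) <= Normc.normc (vdot w (T *m w)) ^+ 2.
  have [->|w0] := eqVneq w 0.
    by rewrite mulmx0 normsq0 !mulr0 sqr_ge0.
  have nw : 0 < normsq w by rewrite normsq_gt0.
  pose a := Num.sqrt (normsq w)^-1.
  have a2 : a ^+ 2 = (normsq w)^-1 by rewrite sqr_sqrtr // invr_ge0 ltW.
  have u1 : normsq (a%:C *: w) = 1 by rewrite normsqZr a2 mulVf // gt_eqF.
  have : k <= Normc.normc (vdot (a%:C *: w) (T *m (a%:C *: w))) ^+ 2 / normsq (T *m (a%:C *: w)).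
    by apply: ge_inf; [case: infS|exists (a%:C *: w)].
  rewrite ler_pdivlMr ?Tpos // -scalemxAr normsqZr vdotZZ a2.
  rewrite Normc.normcM exprMn normc_real_sqr.
  move: (Normc.normc _ ^+ 2) (normsq (T *m w)) => N g.
  have -> : k * ((normsq w)^-1 * g) = k * (normsq w * g) * (normsq w)^-1 ^+ 2.
    by field; rewrite gt_eqF.
  by rewrite [X in _ <= X]mulrC ler_pM2r // exprn_gt0 // invr_gt0.
(* Chosen so that t0 L / l, eps L / l and eps / t0 are each at most eta / 3. *)
pose t0 := eta * l / (3 * L).
have t00 : 0 < t0 by rewrite divr_gt0 ?mulr_gt0 ?ltr0n.
have h3 : t0 * L / l = eta / 3 by rewrite /t0; field; rewrite !gt_eqF.
clearbody t0.
pose eps := Num.min (eta * t0 / 3) t0.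
have eps0 : 0 < eps by rewrite lt_min t00 andbT divr_gt0 ?mulr_gt0 ?ltr0n.
have heta : eps / t0 + (t0 + eps) * L / l <= eta.
  have h1 : eps / t0 <= eta / 3.
    by rewrite ler_pdivrMr // ge_min mulrAC lexx.
  have h2 : (t0 + eps) * L / l <= 2 * (t0 * L / l).
    have -> : 2 * (t0 * L / l) = (t0 + t0) * L / l by field; rewrite gt_eqF.
    by rewrite ler_pM2r ?invr_gt0 // ler_pM2r // lerD2l ge_min lexx orbT.
  by move: h1 h2; rewrite h3; lra.
have [_ [x /= x1 <-] hx] := inf_adherent eps0 infS.
have gs0 := Tpos x x1.
set gs := normsq (T *m x) in gs0 hx.
pose bs := vdot x (T *m x); rewrite -/bs in hx.
pose B := Normc.normc bs ^+ 2.
have hB : B <= (k + eps) * gs by rewrite -ler_pdivrMr // ltW.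
exists (gs^-1%:C * (bs^*)%R) => z.
have [->|z0] := eqVneq z 0.
  by rewrite mulmx0 scaler0 subr0 normsq0 mulr0.
have nz : 0 < normsq z by rewrite normsq_gt0.
pose b := vdot z (T *m z).
have -> : normsq (z - (gs^-1%:C * (bs^*)%R) *: (T *m z)) =
   normsq z - 2 * (complex.Re ((bs^*)%R * b) / gs) + B / gs ^+ 2 * normsq (T *m z).
  rewrite normsqB normsqZ vdotZr Normc.normcM exprMn normcJ -/b -/B.
  rewrite normc_real_sqr exprVn.
  have -> : complex.Re (gs^-1%:C * (bs^*)%R * b) = complex.Re ((bs^*)%R * b) / gs.
    by rewrite -mulrA; case: ((bs^*)%R * b) => c d /=; rewrite mul0r subr0 mulrC.
  by ring.
apply: (@le_trans _ _ ((1 - k + eta) * normsq z)); last first.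
  by rewrite ler_pM2r // lerD2r lerD2l lerN2.
apply: (@first_order_step k eps t0 l L eta (normsq z) _ gs B) => //;
  rewrite ?normsq_ge0 ?(ltW eps0) ?(ltW L0) //; last first.
  by have := hl x; rewrite x1 mulr1.
set t := t0 / normsq z.
have tp : 0 < t by rewrite divr_gt0.
have [w [w1 w2 w3]] := merge_two_vectors T x ((Num.sqrt t)%:C *: z).
have st2 : Num.sqrt t ^+ 2 = t by rewrite sqr_sqrtr // ltW.
move: w1 w2 w3; rewrite -!scalemxAr !normsqZr vdotZZ st2 x1.
rewrite -/gs -/bs -/b => w1 w2 w3.
have := hk w; rewrite w1 w2.
have -> : Normc.normc (bs + t%:C * b) ^+ 2 =
  B + 2 * t * complex.Re ((bs^*)%R * b) + t ^+ 2 * Normc.normc b ^+ 2.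
  rewrite /B !normc_sqr; case: (bs) (b) => c1 d1 [c2 d2] /=; ring.
move=> h; apply: (le_trans _ (le_trans h _)).
  apply: ler_wpM2l => //; apply: ler_wpM2l => //.
  by rewrite addr_ge0 // mulr_ge0 ?normsq_ge0 // ltW.
rewrite lerD2l ler_wpM2l ?sqr_ge0 //; exact: cauchy_schwarz.
Qed.

End Minimax.

(** * Gram determinants *)

Section Gram.
Variable R : rcfType.

Definition gram m n (X : 'M[R[i]]_(m, n)) : 'M[R[i]]_n := X^t* *m X.

Lemma gram_hermitian m n (X : 'M[R[i]]_(m, n)) : gram X \is hermsymmx.
Proof. by apply/is_hermitianmxP; rewrite expr0 scale1r /gram adjmxM trmxCK. Qed.

Lemma gram_normal m n (X : 'M[R[i]]_(m, n)) : gram X \is normalmx.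
Proof. exact/hermitian_normalmx/gram_hermitian. Qed.

Lemma det_gram_mul m n (X : 'M[R[i]]_(m, n)) (L : 'M[R[i]]_n) :
  \det (gram (X *m L)) = (Normc.normc (\det L) ^+ 2)%:C * \det (gram X).
Proof.
rewrite /gram adjmxM -mulmxA (mulmxA _ X) !det_mulmx det_map_mx det_tr.
by rewrite mulrCA mulrC conj_mul_normc.
Qed.

Lemma det_gram_row_orthogonal m n (u : 'cV[R[i]]_m) (X : 'M[R[i]]_(m, n)) :
  u^t* *m X = 0 -> \det (gram (row_mx u X)) = (normsq u)%:C * \det (gram X).
Proof.
move=> uX; have Xu : X^t* *m u = 0.
  by rewrite -[LHS]trmxCK adjmxM trmxCK uX trmx0 map_mx0.
rewrite /gram tr_row_mx map_col_mx mul_col_row uX Xu det_ublock.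
congr (_ * _); rewrite -vdotxx /vdot {1}[u^t* *m u]mx11_scalar det_scalar1.
by [].
Qed.

Lemma det_gram_addl m n (u : 'cV[R[i]]_m) (X : 'M[R[i]]_(m, n)) (a : 'cV[R[i]]_n) :
  \det (gram (row_mx (u + X *m a) X)) = \det (gram (row_mx u X)).
Proof.
have -> : row_mx (u + X *m a) X = row_mx u X *m block_mx 1%:M 0 a 1%:M.
  by rewrite mul_row_block !mulmx1 mulmx0 add0r.
by rewrite det_gram_mul det_lblock !det1 mulr1 Normc.normc1 expr1n mul1r.
Qed.

Lemma det_gram_addr m n (u : 'cV[R[i]]_m) (X : 'M[R[i]]_(m, n)) (t : 'rV[R[i]]_n) :
  \det (gram (row_mx u (X + u *m t))) = \det (gram (row_mx u X)).
Proof.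
have -> : row_mx u (X + u *m t) = row_mx u X *m block_mx 1%:M t 0 1%:M.
  by rewrite mul_row_block !mulmx1 mulmx0 addr0 addrC.
by rewrite det_gram_mul det_ublock !det1 mulr1 Normc.normc1 expr1n mul1r.
Qed.

Definition orthoproj m (u : 'cV[R[i]]_m) : 'M[R[i]]_m :=
  1%:M - (normsq u)^-1%:C *: (u *m u^t*).

Lemma adj_mul_self n (u : 'cV[R[i]]_n) : u^t* *m u = (normsq u)%:C%:M.
Proof. by rewrite [LHS]mx11_scalar -vdotxx. Qed.

Lemma orthoproj_self m (u : 'cV[R[i]]_m) : u != 0 -> orthoproj u *m u = 0.
Proof.
move=> u0; rewrite /orthoproj mulmxBl mul1mx -scalemxAl -mulmxA adj_mul_self.
by rewrite mul_mx_scalar scalerA -rmorphM /= mulVf ?normsq_eq0 // scale1r subrr.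
Qed.

Lemma normsq_orthoproj m (u x : 'cV[R[i]]_m) :
  normsq (orthoproj u *m x) <= normsq x.
Proof.
have -> : orthoproj u *m x = x - ((normsq u)^-1%:C * vdot u x) *: u.
  rewrite /orthoproj mulmxBl mul1mx -scalemxAl -mulmxA.
  by rewrite [u^t* *m x]mx11_scalar mul_mx_scalar scalerA.
have [->|u0] := eqVneq u 0; first by rewrite scaler0 subr0.
rewrite normsqB normsqZ vdotZr Normc.normcM exprMn normc_real_sqr (vdotC u x).
set b := vdot u x.
have -> : complex.Re ((normsq u)^-1%:C * b * (b^*)%R) = (normsq u)^-1 * Normc.normc b ^+ 2.
  by rewrite -mulrA (mulrC b) conj_mul_normc -rmorphM.
have nu : 0 < normsq u by rewrite normsq_gt0.
set N := Normc.normc b ^+ 2.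
have -> : normsq x + (normsq u)^-1 ^+ 2 * N * normsq u - 2 * ((normsq u)^-1 * N) =
  normsq x - N / normsq u by field; rewrite gt_eqF.
by rewrite gerBl divr_ge0 ?sqr_ge0 // ltW.
Qed.

(** Both sides are the Gram determinant of u and the columns of X, which does
    not change when multiples of X are added to u, or of u to X. *)
Lemma residual_gram_ratio m n (u : 'cV[R[i]]_m) (X : 'M[R[i]]_(m, n)) a :
  u != 0 -> X^t* *m (u + X *m a) = 0 ->
  (normsq (u + X *m a))%:C * \det (gram X) =
  (normsq u)%:C * \det (gram (orthoproj u *m X)).
Proof.
move=> u0 Xr; rewrite -!det_gram_row_orthogonal.
- rewrite det_gram_addl.
  have -> : orthoproj u *m X = X + u *m (- ((normsq u)^-1%:C *: (u^t* *m X))).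
    by rewrite /orthoproj mulmxBl mul1mx -scalemxAl -mulmxA mulmxN -scalemxAr.
  by rewrite det_gram_addr.
- rewrite /orthoproj mulmxA mulmxBr mulmx1 -scalemxAr mulmxA adj_mul_self.
  rewrite mul_scalar_mx scalerA -rmorphM mulVf ?normsq_eq0 //= scale1r subrr.
  by rewrite mul0mx.
- by rewrite -[LHS]trmxCK adjmxM trmxCK Xr trmx0 map_mx0.
Qed.

Lemma spectral_gramE m n (V : 'M[R[i]]_(m, n)) (x : 'cV[R[i]]_n) :
  normsq (V *m x) = \sum_(i < n) complex.Re (spectral_diag (gram V) 0 i) *
     Normc.normc ((spectralmx (gram V) *m x) i 0) ^+ 2.
Proof.
set P := spectralmx _; set d := spectral_diag _.
have e : gram V = P^t* *m diag_mx d *m P.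
  by rewrite {1}[gram V](orthomx_spectralP (gram_normal V)) invmx_unitary ?spectral_unitarymx.
rewrite /normsq vdot_mul mulmxA -/(gram V) e -!mulmxA -[P^t*]trmxCK.
rewrite trmxCK -vdot_mul /vdot mxE raddf_sum; apply: eq_bigr => i _.
rewrite mul_diag_mx !mxE mulrCA conj_mul_normc.
by case: (d 0 i) => p q /=; rewrite mulr0 subr0.
Qed.

Lemma normsq_spectralmx n (S : 'M[R[i]]_n) (x : 'cV[R[i]]_n) :
  normsq (spectralmx S *m x) = normsq x.
Proof.
have /unitarymxP h := spectral_unitarymx S.
rewrite /normsq vdot_mul mulmxA.
have -> : (spectralmx S)^t* *m spectralmx S = 1%:M by apply: mulmx1C.
by rewrite mul1mx.
Qed.

Lemma spectral_gram_ge0 m n (V : 'M[R[i]]_(m, n)) i :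
  0 <= complex.Re (spectral_diag (gram V) 0 i).
Proof.
have /unitarymxP h := spectral_unitarymx (gram V).
have := normsq_ge0 (V *m ((spectralmx (gram V))^t* *m delta_mx i 0)).
rewrite spectral_gramE mulmxA h mul1mx (bigD1 i) //= big1 => [|j ji].
  by rewrite mxE !eqxx addr0 Normc.normc1 expr1n mulr1.
by rewrite mxE (negPf ji) Normc.normc0 expr0n mulr0.
Qed.

Lemma det_gram_spectral m n (V : 'M[R[i]]_(m, n)) :
  \det (gram V) = (\prod_(i < n) complex.Re (spectral_diag (gram V) 0 i))%:C.
Proof.
have /mxOverP re := hermitian_spectral_diag_real (gram_hermitian V).
rewrite {1}[gram V](orthomx_spectralP (gram_normal V)) !det_mulmx mulrAC -det_mulmx.
rewrite mulVmx ?spectral_unit // det1 mul1r det_diag rmorph_prod.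
by apply: eq_bigr => i _; apply/esym/RRe_real/re.
Qed.

(** The counting condition says that the j-th largest entry of s, counted from
    zero, is at most b j. *)
Lemma prod_le_of_count (s : seq R) (b : nat -> R) :
  (forall x, x \in s -> 0 <= x) ->
  (forall j, (j < size s)%N -> (count (fun x => b j < x)%R s <= j)%N) ->
  \prod_(x <- s) x <= \prod_(0 <= j < size s) b j.
Proof.
move=> s0 hc; have ps := permEl (perm_sort >=%R s).
rewrite -(perm_big _ ps) -(perm_size ps) (big_nth 0).
rewrite big_seq [X in _ <= X]big_seq; apply: ler_prod => j; rewrite mem_index_iota => js.
have js' : (j < size s)%N by rewrite -(perm_size ps).
set s' := sort _ s in ps js *.
apply/andP; split.
  by apply: s0; rewrite -(perm_mem ps) mem_nth.
rewrite leNgt; apply/negP => hb.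
have := hc j js'; rewrite -(permP ps) -[s'](cat_take_drop j.+1) count_cat.
have : all (fun x => b j < x)%R (take j.+1 s').
  apply/(all_nthP 0) => l; rewrite size_take_min => hl.
  have lj : (l < j.+1)%N by rewrite (leq_trans hl) // geq_minl.
  rewrite nth_take //; apply: (lt_le_trans hb).
  have srt : sorted >=%R s' by apply: sort_sorted => a c; exact: le_total.
  apply: (sorted_leq_nth ge_trans ge_refl 0 srt); rewrite ?inE //.
  by rewrite (leq_ltn_trans _ js).
rewrite all_count size_take_min => /eqP ->.
by rewrite (minn_idPl js) addSn ltnNge leq_addr.
Qed.

(** Otherwise the eigenvectors for eigenvalues above b span a space large enough
    to meet the kernel of Z nontrivially, and there V stretches squared norms by more than b. *)
Lemma spectral_count m n (V : 'M[R[i]]_(m, n)) p (Z : 'M[R[i]]_(p, n)) (b : R) :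
  (forall x, Z *m x = 0 -> normsq (V *m x) <= b * normsq x) ->
  (#|[set i | (b < complex.Re (spectral_diag (gram V) 0 i))%R]| <= p)%N.
Proof.
move=> hZ; set I := [set i | _]; rewrite leqNgt; apply/negP => pI.
pose P := spectralmx (gram V).
pose L := col_mx Z (\matrix_(i < #|~: I|) row (enum_val i) P).
have [|x x0] := @exists_nonzero_kernel R[i] _ _ L.
  by rewrite -[X in (_ < X)%N](card_ord n) -(cardsC I) ltn_add2r.
rewrite mul_col_mx => /eqP; rewrite col_mx_eq0 => /andP[/eqP Zx /eqP Px].
have Px0 i : i \notin I -> (P *m x) i 0 = 0.
  move=> iI; have iC : i \in ~: I by rewrite inE.
  have := congr1 (fun A : 'cV_(_) => A (enum_rank_in iC i) 0) Px.
  rewrite !mxE => e; rewrite -[RHS]e; apply: eq_bigr => l _.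
  by rewrite !mxE enum_rankK_in.
have := hZ x Zx; rewrite spectral_gramE -(normsq_spectralmx (gram V) x).
rewrite -/P normsq_sum mulr_sumr -subr_le0 -sumrB leNgt => /negP; apply.
have ge0 i : 0 <= complex.Re (spectral_diag (gram V) 0 i) * Normc.normc ((P *m x) i 0) ^+ 2 -
    b * Normc.normc ((P *m x) i 0) ^+ 2.
  rewrite -mulrBl; have [|/Px0->] := boolP (i \in I).
    by rewrite inE => /ltW h; rewrite mulr_ge0 ?sqr_ge0 // subr_ge0.
  by rewrite Normc.normc0 expr0n mulr0.
rewrite lt_def sumr_ge0 // andbT psumr_eq0 //; apply/negP => /allP h.
move/eqP: x0; apply; apply/eqP; rewrite -normsq_eq0 -(normsq_spectralmx (gram V) x).
rewrite normsq_eq0; apply/eqP/matrixP => i j; rewrite (ord1 j) [RHS]mxE -/P.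
have [iI|/Px0//] := boolP (i \in I).
have := h i (mem_index_enum _); rewrite -mulrBl mulf_eq0 subr_eq0.
rewrite inE in iI; rewrite (gt_eqF iI) sqrf_eq0 => /eqP.
exact: Normc.eq0_normc.
Qed.

(** The Gram-Schmidt process applied to the columns of X. *)
Lemma orthonormal_factor N k (X : 'M[R[i]]_(N, k)) : (k <= N)%N ->
  exists (W : 'M[R[i]]_(N, k)) (Y : 'M[R[i]]_k), gram W = 1%:M /\ X = W *m Y.
Proof.
move=> kN; have /submxP[D XE] := schmidt_sub X^T.
exists (schmidt X^T)^T, D^T; split; last by rewrite -trmx_mul -XE trmxK.
have /unitarymxP h := schmidt_unitarymx X^T kN.
have -> : gram (schmidt X^T)^T = (schmidt X^T *m (schmidt X^T)^t*)^T.
  by rewrite /gram trmx_mul trmxK map_trmx trmxK.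
by rewrite h trmx1.
Qed.

(** After factoring X = W Y with orthonormal columns in W, both determinants have
    the factor |det Y|^2, and det (gram (F W)) is the product of the eigenvalues, of
    which the j-th largest, counted from zero, is at most b j. *)
Lemma det_gram_le N k p (X : 'M[R[i]]_(N, k)) (F : 'M[R[i]]_(p, N)) (b : nat -> R) :
  (k <= N)%N ->
  (forall j, (j < k)%N -> exists m (Z : 'M[R[i]]_(m, N)), (m <= j)%N /\
     forall x, Z *m x = 0 -> normsq (F *m x) <= b j * normsq x) ->
  complex.Re (\det (gram (F *m X))) <= (\prod_(0 <= j < k) b j) * complex.Re (\det (gram X)).
Proof.
move=> kN hF; have [W [Y [W1 ->]]] := orthonormal_factor X kN.
rewrite mulmxA !det_gram_mul W1 det1 mulr1 det_gram_spectral -rmorphM /=.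
rewrite mulrC ler_wpM2r ?sqr_ge0 //.
pose d (i : 'I_k) := complex.Re (spectral_diag (gram (F *m W)) 0 i).
have -> : \prod_(i < k) complex.Re (spectral_diag (gram (F *m W)) 0 i) =
    \prod_(x <- [seq d i | i <- enum 'I_k]) x.
  by rewrite big_map big_enum.
have sz : size [seq d i | i <- enum 'I_k] = k by rewrite size_map size_enum_ord.
apply: (@le_trans _ _ (\prod_(0 <= j < size [seq d i | i <- enum 'I_k]) b j)).
  2: by rewrite sz.
apply: prod_le_of_count => [x /mapP[i _ ->]|j].
  exact: spectral_gram_ge0.
rewrite sz => jk; have [m [Z [mj hZ]]] := hF j jk.
apply: leq_trans mj; rewrite count_map.
apply: leq_trans (@spectral_count _ _ (F *m W) _ (Z *m W) (b j) _).
  rewrite -size_filter cardE; apply: uniq_leq_size.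
    by rewrite filter_uniq ?enum_uniq.
  by move=> i; rewrite mem_filter => /andP[h _]; rewrite mem_enum inE.
move=> x; rewrite -!mulmxA => /hZ.
have -> : normsq (W *m x) = normsq x; last by [].
by rewrite /normsq vdot_mul mulmxA -/(gram W) W1 mul1mx.
Qed.

End Gram.

(** * Krylov matrices and orthogonal residuals *)

Section Krylov.
Variable R : rcfType.

Definition krylovmx N (A : 'M[R[i]]_N) (u : 'cV[R[i]]_N) k : 'M[R[i]]_(N, k) :=
  \matrix_(i, j) (A ^+ j *m u) i 0.

Lemma krylovmxE N (A : 'M[R[i]]_N) u k (y : 'cV[R[i]]_k) :
  krylovmx A u k *m y = \sum_j y j 0 *: (A ^+ j *m u).
Proof.
apply/matrixP => i l; rewrite (ord1 l) mxE summxE; apply: eq_bigr => j _.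
by rewrite !mxE mulrC.
Qed.

(** Existence of least squares solutions, whatever the rank of X. *)
Lemma exists_orthogonal_residual m n (X : 'M[R[i]]_(m, n)) (u : 'cV[R[i]]_m) :
  exists a, X^t* *m (u + X *m a) = 0.
Proof.
have /submxP[D hD] := proj_ortho_sub X^T u^T.
have := proj_ortho_compl_sub X^T u^T; rewrite hD => /orthomx1P h.
exists (- D^T).
have -> : u + X *m (- D^T) = (u^T - D *m X^T)^T.
  by rewrite [RHS]raddfB /= trmx_mul !trmxK mulmxN.
have -> : X^t* = ((X^T)^t*)^T by rewrite trmxK map_trmx.
by rewrite -trmx_mul h trmx0.
Qed.

Lemma orthogonal_residual_min m n (X : 'M[R[i]]_(m, n)) (u : 'cV[R[i]]_m) a b :
  X^t* *m (u + X *m a) = 0 -> normsq (u + X *m a) <= normsq (u + X *m b).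
Proof.
have -> : u + X *m b = X *m (b - a) + (u + X *m a).
  by rewrite mulmxBr addrCA subrK.
move: (u + X *m a) => r h.
rewrite normsqD vdot_mul h /vdot mulmx0 mxE mulr0 addr0.
by rewrite lerDr normsq_ge0.
Qed.

(** Divide the relation by the power of A in its first nonzero term; then u occurs
    in it with a nonzero coefficient. *)
Lemma krylov_dependence N (A : 'M[R[i]]_N) (u : 'cV[R[i]]_N) : A \in unitmx ->
  forall k (y : nat -> R[i]), \sum_(0 <= j < k) y j *: (A ^+ j *m u) = 0 ->
  (exists2 j, (j < k)%N & y j != 0) ->
  exists z : nat -> R[i], u = \sum_(0 <= j < k) z j *: (A ^+ j.+1 *m u).
Proof.
move=> uA; elim=> [|k IH] y; first by move=> _ [].
rewrite big_nat_recl // expr0 mul1mx.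
have [y0|y0] := eqVneq (y 0%N) 0.
  rewrite y0 scale0r add0r => h [[|j] jk yj]; first by rewrite y0 eqxx in yj.
  have [||z hz] := IH (fun j => y j.+1).
  - have : invmx A *m \sum_(0 <= i < k) y i.+1 *: (A ^+ i.+1 *m u) = 0 by rewrite h mulmx0.
    rewrite mulmx_sumr => e; rewrite -[RHS]e; apply: eq_bigr => l _.
    by rewrite -scalemxAr exprS -mulmxA mulKmx.
  - by exists j.
  exists (fun j => if (j < k)%N then z j else 0).
  rewrite big_nat_recr //= ltnn scale0r addr0 [LHS]hz.
  by apply: eq_big_nat => l /= ->.
move=> h _; exists (fun j => if (j < k)%N then - (y j.+1 / y 0%N) else 0).
rewrite big_nat_recr //= ltnn scale0r addr0.
transitivity (\sum_(0 <= j < k) - (y j.+1 / y 0%N) *: (A ^+ j.+1 *m u)); last first.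
  by apply: eq_big_nat => l /= ->.
apply: (scalerI y0); move/eqP: h; rewrite addr_eq0 => /eqP ->.
rewrite scaler_sumr -sumrN; apply: eq_bigr => l _.
by rewrite scalerA mulrN mulrCA mulfV // mulr1 scaleNr.
Qed.

(** If the Krylov vectors were dependent, u would lie in the range of A K, and the
    residual, orthogonal to that range and contained in it, would vanish. *)
Lemma krylovmx_inj N (A : 'M[R[i]]_N) (u : 'cV[R[i]]_N) k a : A \in unitmx ->
  (A *m krylovmx A u k)^t* *m (u + A *m krylovmx A u k *m a) = 0 ->
  u + A *m krylovmx A u k *m a != 0 ->
  forall y : 'cV[R[i]]_k, krylovmx A u k *m y = 0 -> y = 0.
Proof.
move=> uA h r0 y Ky; apply/eqP/negPn/negP => y0; move/eqP: r0; apply; apply/eqP.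
have [z uz] : exists z : 'cV_k, u = A *m krylovmx A u k *m z.
  pose y' j := if insub j is Some i then y i 0 else 0.
  have y'E (i : 'I_k) : y' i = y i 0 by rewrite /y' valK.
  have [||z hz] := @krylov_dependence N A u uA k y'.
  - by rewrite big_mkord -[RHS]Ky krylovmxE; apply: eq_bigr => i _; rewrite y'E.
  - have [i yi] : exists i, y i 0 != 0.
      apply/existsP; apply: contraR y0 => /existsPn h0.
      by apply/eqP/matrixP => i j; rewrite (ord1 j) mxE; move: (h0 i) => /negPn/eqP.
    by exists i; rewrite ?y'E.
  exists (\col_i z i); rewrite -mulmxA krylovmxE mulmx_sumr {1}hz big_mkord.
  by apply: eq_bigr => i _; rewrite mxE exprS -scalemxAr -mulmxA.
move: h uz; set X := A *m _ => h uz.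
have rE : u + X *m a = X *m (z + a) by rewrite mulmxDr -uz.
by rewrite -normsq_eq0 /normsq {1}rE vdot_mul h /vdot mulmx0 mxE.
Qed.

(** Multiplication by 1 - c A^-1 subtracts from each column of X = A K the multiple
    by c of the preceding one, and from the first column the multiple by c of u, which
    the projection kills. After the projection this is a unit upper triangular column
    operation. *)
Lemma det_gram_krylov_shift N (A : 'M[R[i]]_N) (u : 'cV[R[i]]_N) k (c : R[i]) :
  A \in unitmx -> u != 0 ->
  let X := A *m krylovmx A u k in
  \det (gram (orthoproj u *m X)) =
  \det (gram (orthoproj u *m (1%:M - c *: invmx A) *m X)).
Proof.
move=> uA u0 X.
(* S shifts the columns by one place, with a zero column coming in first. *)
pose S : 'M[R[i]]_k := \matrix_(i, j) (i.+1 == j)%:R.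
have XE i (j : 'I_k) : X i j = (A ^+ j.+1 *m u) i 0.
  rewrite exprS -mulmxA /X [LHS]mxE [RHS]mxE.
  by apply: eq_bigr => l _; rewrite mxE.
have QK : orthoproj u *m krylovmx A u k = orthoproj u *m X *m S.
  have colK (j : 'I_k) : col j (krylovmx A u k) = A ^+ j *m u.
    by apply/matrixP => i l; rewrite (ord1 l) !mxE.
  have colX (j : 'I_k) : col j X = A ^+ j.+1 *m u.
    by apply/matrixP => i l; rewrite (ord1 l) [LHS]mxE XE.
  apply/matrixP => i j.
  transitivity (col j (orthoproj u *m krylovmx A u k) i 0); first by rewrite !mxE.
  rewrite colE -mulmxA -colE colK; case: j => -[|j] jk /=.
    rewrite expr0 mul1mx orthoproj_self // [LHS]mxE [RHS]mxE big1 // => l _.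
    by rewrite [S _ _]mxE mulr0.
  have jk' : (j < k)%N by apply: ltnW.
  rewrite -(colX (Ordinal jk')) colE mulmxA -colE mxE [RHS]mxE (bigD1 (Ordinal jk')) //=.
  rewrite big1 => [|l lj]; first by rewrite [S _ _]mxE /= eqxx mulr1 addr0.
  rewrite [S _ _]mxE /= eqSS; case: eqP => [e|_]; last by rewrite mulr0.
  by move/eqP: lj; case; apply: val_inj.
have -> : orthoproj u *m (1%:M - c *: invmx A) *m X = orthoproj u *m X *m (1%:M - c *: S).
  have GX : (1%:M - c *: invmx A) *m X = X - c *: krylovmx A u k.
    by rewrite mulmxBl mul1mx -scalemxAl /X mulKmx.
  rewrite -mulmxA GX; move: (orthoproj u) QK => Q QK.
  by rewrite mulmxBr -scalemxAr QK mulmxBr mulmx1 -scalemxAr.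
rewrite [RHS]det_gram_mul.
have -> : \det (1%:M - c *: S) = 1.
  rewrite -det_tr det_trig.
    rewrite big1 // => i _; rewrite !mxE eqxx.
    by rewrite gtn_eqF // mulr0 subr0.
  apply/is_trig_mxP => i j ij; rewrite !mxE.
  rewrite [j == i]eq_sym -val_eqE /= (ltn_eqF ij).
  by rewrite gtn_eqF ?mulr0 ?subr0 // ltnW.
by rewrite Normc.normc1 expr1n mul1r.
Qed.

(** A zero residual leaves nothing to prove. Otherwise the Krylov vectors are
    independent; this bounds k by N and makes the determinant of gram X positive, so
    that it can be cancelled between [residual_gram_ratio] and [det_gram_le]. *)
Lemma orthogonal_residual_le_prod N (A : 'M[R[i]]_N) (u : 'cV[R[i]]_N) k a c
    (b : nat -> R) :
  A \in unitmx -> (forall j, 0 <= b j) ->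
  (A *m krylovmx A u k)^t* *m (u + A *m krylovmx A u k *m a) = 0 ->
  (forall j, (j < N)%N -> exists m (Z : 'M[R[i]]_(m, N)), (m <= j)%N /\
     forall x, Z *m x = 0 -> normsq ((1%:M - c *: invmx A) *m x) <= b j * normsq x) ->
  normsq (u + A *m krylovmx A u k *m a) <= (\prod_(0 <= j < k) b j) * normsq u.
Proof.
move=> uA b0 h hb.
have [u0|u0] := eqVneq u 0.
  have := orthogonal_residual_min 0 h; rewrite mulmx0 addr0 u0 => /le_trans; apply.
  by rewrite normsq0 mulr0.
have pr0 : 0 <= \prod_(0 <= j < k) b j by apply: prodr_ge0.
have [->|r0] := eqVneq (u + A *m krylovmx A u k *m a) 0.
  by rewrite normsq0 mulr_ge0 ?normsq_ge0.
have inj := krylovmx_inj uA h r0.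
have kN : (k <= N)%N.
  rewrite leqNgt; apply/negP => Nk.
  have [y y0 Ky] := @exists_nonzero_kernel _ _ _ (krylovmx A u k) Nk.
  by move: y0; rewrite (inj y Ky) eqxx.
set X := A *m _ in h r0 *.
have Xinj (y : 'cV[R[i]]_k) : X *m y = 0 -> y = 0.
  move=> Xy; apply: inj; rewrite -[LHS](mulKmx uA).
  by rewrite [A *m (_ *m y)]mulmxA -/X Xy mulmx0.
have dX : 0 < complex.Re (\det (gram X)).
  rewrite det_gram_spectral /=; apply: prodr_gt0 => i _.
  rewrite lt_def spectral_gram_ge0 andbT; apply/negP => /eqP d0.
  have /unitarymxP hP := spectral_unitarymx (gram X).
  pose y := (spectralmx (gram X))^t* *m delta_mx i 0 : 'cV_k.
  have Py : spectralmx (gram X) *m y = delta_mx i 0 by rewrite /y mulmxA hP mul1mx.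
  have : normsq (X *m y) = 0.
    rewrite spectral_gramE Py big1 // => j _; rewrite mxE.
    have [->|ji] := eqVneq j i; first by rewrite d0 mul0r.
    by rewrite Normc.normc0 expr0n mulr0.
  move=> /eqP; rewrite normsq_eq0 => /eqP/Xinj y0.
  have := congr1 (fun A : 'cV_k => A i 0) Py; rewrite y0 mulmx0 !mxE !eqxx.
  by move=> /eqP; rewrite eq_sym oner_eq0.
have := residual_gram_ratio u0 h.
rewrite (det_gram_krylov_shift k c uA u0) -/X => e.
have le := det_gram_le X (F := orthoproj u *m (1%:M - c *: invmx A)) (b := b) kN.
have {}le : complex.Re (\det (gram (orthoproj u *m (1%:M - c *: invmx A) *m X))) <=
    \prod_(0 <= j < k) b j * complex.Re (\det (gram X)).
  apply: le => j jk; have [m [Z [mj hZ]]] := hb j (leq_trans jk kN).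
  exists m, Z; split; first exact: mj.
  move=> x Zx; apply: le_trans (hZ x Zx); rewrite -mulmxA.
  exact: normsq_orthoproj.
rewrite -(ler_pM2r dX).
have -> : normsq (u + X *m a) * complex.Re (\det (gram X)) =
  normsq u * complex.Re (\det (gram (orthoproj u *m (1%:M - c *: invmx A) *m X))).
  by rewrite -!Re_realM e.
rewrite mulrAC [X in _ <= X]mulrC ler_wpM2l ?normsq_ge0 //.
Qed.
End Krylov.

(** * Spectral norm, Frobenius norm and singular values *)

Section Norms.
Variable R : realType.

Lemma l2normE N (x : 'cV[R[i]]_N) : l2norm x = Num.sqrt (normsq x).
Proof. by rewrite normsq_sum. Qed.

Lemma l2norm_ge0 N (x : 'cV[R[i]]_N) : 0 <= l2norm x.
Proof. exact: sqrtr_ge0. Qed.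

Lemma sqr_l2norm N (x : 'cV[R[i]]_N) : l2norm x ^+ 2 = normsq x.
Proof. by rewrite l2normE sqr_sqrtr ?normsq_ge0. Qed.

Lemma l2norm_le_sqr N (x : 'cV[R[i]]_N) (b : R) : 0 <= b ->
  (l2norm x <= b) = (normsq x <= b ^+ 2).
Proof. by move=> b0; rewrite -sqr_l2norm ler_pXn2r ?nnegrE ?l2norm_ge0. Qed.

Lemma l2normZr N (a : R) (x : 'cV[R[i]]_N) : 0 <= a -> l2norm (a%:C *: x) = a * l2norm x.
Proof.
by move=> a0; rewrite !l2normE normsqZr sqrtrM ?sqr_ge0 // sqrtr_sqr ger0_norm.
Qed.

Lemma l2norm0 N : l2norm (0 : 'cV[R[i]]_N) = 0.
Proof. by rewrite l2normE normsq0 sqrtr0. Qed.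

Lemma l2norm_eq0 N (x : 'cV[R[i]]_N) : (l2norm x == 0) = (x == 0).
Proof. by rewrite -normsq_eq0 -sqr_l2norm sqrf_eq0. Qed.

Lemma l2normD N (x y : 'cV[R[i]]_N) : l2norm (x + y) <= l2norm x + l2norm y.
Proof.
rewrite l2norm_le_sqr ?addr_ge0 ?l2norm_ge0 // sqrrD !sqr_l2norm normsqD.
suff : complex.Re (vdot x y) <= l2norm x * l2norm y by lra.
have [h|h] := leP (complex.Re (vdot x y)) 0.
  by rewrite (le_trans h) // mulr_ge0 ?l2norm_ge0.
rewrite -(@ler_pXn2r _ 2) ?nnegrE ?mulr_ge0 ?l2norm_ge0 ?(ltW h) //.
rewrite exprMn !sqr_l2norm; apply: le_trans (cauchy_schwarz x y).
by rewrite normc_sqr lerDl sqr_ge0.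
Qed.

Lemma l2normN N (x : 'cV[R[i]]_N) : l2norm (- x) = l2norm x.
Proof.
by rewrite !l2normE -scaleN1r normsqZ normc_sqr /= oppr0 sqrrN expr1n expr0n addr0 mul1r.
Qed.

(** Both sides are the trace of gram T. *)
Lemma frobenius_spectral N (T : 'M[R[i]]_N) :
  frobenius_norm T ^+ 2 = \sum_i complex.Re (spectral_diag (gram T) 0 i).
Proof.
rewrite /frobenius_norm sqr_sqrtr; last first.
  by apply: sumr_ge0 => i _; apply: sumr_ge0 => j _; exact: sqr_ge0.
transitivity (complex.Re (\tr (gram T))).
  rewrite exchange_big raddf_sum; apply: eq_bigr => j _ /=.
  have -> : gram T j j = vdot (col j T) (col j T).
    rewrite /gram /vdot [LHS]mxE [RHS]mxE; apply: eq_bigr => l _.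
    by rewrite !mxE.
  by rewrite -/(normsq _) normsq_sum; apply: eq_bigr => l _; rewrite mxE.
rewrite {1}(orthomx_spectralP (gram_normal T)) mxtrace_mulC mulmxA mulmxV ?spectral_unit //.
by rewrite mul1mx mxtrace_diag raddf_sum.
Qed.

Lemma normsq_mul_le N (T : 'M[R[i]]_N) (x : 'cV[R[i]]_N) :
  normsq (T *m x) <= frobenius_norm T ^+ 2 * normsq x.
Proof.
rewrite frobenius_spectral spectral_gramE mulr_suml; apply: ler_sum => i _.
apply: ler_wpM2l; first exact: spectral_gram_ge0.
rewrite -(normsq_spectralmx (gram T) x) normsq_sum (bigD1 i) //= lerDl.
by apply: sumr_ge0 => j _; exact: sqr_ge0.
Qed.

Lemma opnorm_has_ubound N (T : 'M[R[i]]_N) :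
  has_ubound [set l2norm (T *m x) | x in [set x : 'cV[R[i]]_N | l2norm x <= 1]]%classic.
Proof.
exists (frobenius_norm T) => _ [y /= y1 <-].
rewrite l2norm_le_sqr ?sqrtr_ge0 //; apply: (le_trans (normsq_mul_le T y)).
by rewrite ler_piMr ?sqr_ge0 // -sqr_l2norm expr_le1 // l2norm_ge0.
Qed.

Lemma l2norm_mul_le_opnorm N (T : 'M[R[i]]_N) (x : 'cV[R[i]]_N) :
  l2norm (T *m x) <= opnorm T * l2norm x.
Proof.
have [->|x0] := eqVneq x 0; first by rewrite mulmx0 l2norm0 mulr0.
have nx : 0 < l2norm x by rewrite lt_def l2norm_eq0 x0 l2norm_ge0.
rewrite -ler_pdivrMr //; apply: (ub_le_sup (opnorm_has_ubound T)).
exists ((l2norm x)^-1%:C *: x) => /=.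
  by rewrite l2normZr ?invr_ge0 ?l2norm_ge0 // mulVf // gt_eqF.
by rewrite -scalemxAr l2normZr ?invr_ge0 ?l2norm_ge0 // mulrC.
Qed.

Lemma opnorm_ge0 N (T : 'M[R[i]]_N) : 0 <= opnorm T.
Proof.
apply: (ub_le_sup (opnorm_has_ubound T)).
by exists 0; rewrite /= ?mulmx0 l2norm0 ?ler01.
Qed.

Lemma singular_values_sorted N (T : 'M[R[i]]_N) : sorted >=%R (singular_values T).
Proof. by apply: sort_sorted => a c; exact: le_total. Qed.

Lemma size_singular_values N (T : 'M[R[i]]_N) : size (singular_values T) = N.
Proof. by rewrite size_sort size_map size_enum_ord. Qed.

Lemma singular_value_ge0 N (T : 'M[R[i]]_N) j : 0 <= singular_value T j.
Proof.
rewrite /singular_value; have [h|h] := ltnP j.-1 (size (singular_values T)).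
  have := mem_nth 0 h; rewrite mem_sort => /mapP[i _ ->]; exact: sqrtr_ge0.
by rewrite nth_default.
Qed.

(** Require x to be orthogonal to the right singular vectors for singular values
    greater than the one with index j; there are at most j of these, counted from zero. *)
Lemma exists_conditions_singular_value N (T : 'M[R[i]]_N) j : (j < N)%N ->
  exists m (Z : 'M[R[i]]_(m, N)), (m <= j)%N /\
    forall x, Z *m x = 0 -> l2norm (T *m x) <= singular_value T j.+1 * l2norm x.
Proof.
move=> jN; pose s := singular_value T j.+1.
pose d i := complex.Re (spectral_diag (gram T) 0 i).
pose P := spectralmx (gram T).
pose J := [set i | (s < Num.sqrt (d i))%R].
exists #|J|, (\matrix_(i < #|J|) row (enum_val i) P); split.
  have -> : #|J| = count (fun x => s < x)%R (singular_values T).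
    rewrite (permP (permEl (perm_sort _ _))) count_map -size_filter cardE.
    apply: perm_size; apply: uniq_perm => [||i].
    - exact: enum_uniq.
    - exact/filter_uniq/enum_uniq.
    - by rewrite mem_enum mem_filter [i \in enum _]mem_enum inE andbT.
  have sT := size_singular_values T.
  rewrite -(cat_take_drop j (singular_values T)) count_cat.
  have -> : count (fun x => s < x)%R (drop j (singular_values T)) = 0%N.
    apply/eqP; rewrite -leqn0 leqNgt -has_count; apply/hasPn => x /(nthP 0)[l].
    rewrite size_drop sT nth_drop => hl <-; rewrite -leNgt.
    apply: (sorted_leq_nth ge_trans ge_refl 0 (singular_values_sorted T));
      by rewrite ?inE ?sT ?leq_addr // -ltn_subRL.
  rewrite addn0; apply: leq_trans (count_size _ _) _.
  by rewrite size_take_min geq_minl.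
move=> x Zx; rewrite l2norm_le_sqr ?mulr_ge0 ?singular_value_ge0 ?l2norm_ge0 //.
rewrite -/s exprMn sqr_l2norm spectral_gramE -(normsq_spectralmx (gram T) x) normsq_sum mulr_sumr.
apply: ler_sum => i _; have [iJ|iJ] := boolP (i \in J).
  have := congr1 (fun A : 'cV_(_) => A (enum_rank_in iJ i) 0) Zx.
  rewrite !mxE => e.
  have -> : \sum_j0 spectralmx (gram T) i j0 * x j0 0 = 0.
    by rewrite -[RHS]e; apply: eq_bigr => l _; rewrite !mxE enum_rankK_in.
  by rewrite Normc.normc0 expr0n !mulr0.
apply: ler_wpM2r; first exact: sqr_ge0.
move: iJ; rewrite inE -leNgt => h.
rewrite -[X in X <= _]sqr_sqrtr ?spectral_gram_ge0 //.
by rewrite ler_pXn2r ?nnegrE ?sqrtr_ge0 ?singular_value_ge0.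
Qed.

Lemma sum_sqr_singular_value N (T : 'M[R[i]]_N) k :
  \sum_(0 <= j < k) singular_value T j.+1 ^+ 2 <= frobenius_norm T ^+ 2.
Proof.
have -> : frobenius_norm T ^+ 2 = \sum_(x <- singular_values T) x ^+ 2.
  rewrite (perm_big _ (permEl (perm_sort _ _))) big_map big_enum /= frobenius_spectral.
  by apply: eq_bigr => i _; rewrite sqr_sqrtr ?spectral_gram_ge0.
rewrite [X in _ <= X](big_nth 0) size_singular_values.
have [kN|kN] := leqP k N.
  rewrite [X in _ <= X](big_cat_nat _ kN) //= lerDl.
  by apply: sumr_ge0 => i _; exact: sqr_ge0.
rewrite (big_cat_nat _ (ltnW kN)) //= [X in _ + X <= _]big1_seq ?addr0 //.
move=> j; rewrite mem_index_iota => /andP[_ /andP[Nj _]].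
by rewrite /singular_value nth_default ?expr0n //= size_singular_values.
Qed.

End Norms.

(** * GMRES residuals and the rate of GMRES *)

Section Gmres.
Variable R : realType.

Lemma gmres_affineP N (T : 'M[R[i]]_N) (r0 r : 'cV[R[i]]_N) k :
  gmres_affine T r0 k r <-> exists a, r = r0 + T *m krylovmx T r0 k *m a.
Proof.
have szk : size [seq T ^+ i *m r0 | i <- iota 0 k] = k by rewrite size_map size_iota.
have nthk (j : 'I_k) : [seq T ^+ i *m r0 | i <- iota 0 k]`_j = T ^+ j *m r0.
  by rewrite (nth_map 0%N) ?size_iota // nth_iota.
split=> [[y /= yK <-]|[a ->]].
  have szX : size [seq T ^+ i *m r0 | i <- iota 0 k] == k by rewrite szk.
  pose X := Tuple szX.
  have yX : y \in <<X>>%VS by [].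
  exists (\col_j coord X j y); rewrite -mulmxA krylovmxE.
  congr (_ + _ *m _); rewrite {1}(coord_span yX); apply: eq_bigr => j _.
  by rewrite mxE nthk.
exists (krylovmx T r0 k *m a); last by rewrite mulmxA.
rewrite /= krylovmxE; apply: memv_suml => j _; apply/memvZ/memv_span.
by rewrite -nthk mem_nth ?szk.
Qed.

(** The residual is chosen by minimality only, so it is compared in norm with the
    least squares residual. *)
Lemma gmres_residual_orthogonal N (T : 'M[R[i]]_N) (r0 : 'cV[R[i]]_N) k :
  let X := T *m krylovmx T r0 k in
  exists a, X^t* *m (r0 + X *m a) = 0 /\
    l2norm (gmres_residual T r0 k) = l2norm (r0 + X *m a).
Proof.
move=> X; have [a ha] := exists_orthogonal_residual X r0.
have amin s : gmres_affine T r0 k s -> l2norm (r0 + X *m a) <= l2norm s.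
  move=> /gmres_affineP[b ->]; rewrite l2norm_le_sqr ?l2norm_ge0 // sqr_l2norm.
  exact: orthogonal_residual_min.
have aff : gmres_affine T r0 k (r0 + X *m a) by apply/gmres_affineP; exists a.
exists a; split=> //.
have [raff rmin] := @xgetPex _ r0
  [set r | gmres_affine T r0 k r /\ forall s, gmres_affine T r0 k s -> l2norm r <= l2norm s]%classic
  (ex_intro _ _ (conj aff amin)).
by apply/eqP; rewrite eq_le (rmin _ aff) amin.
Qed.

Lemma gmres_residual_min N (T : 'M[R[i]]_N) (r0 s : 'cV[R[i]]_N) k :
  gmres_affine T r0 k s -> l2norm (gmres_residual T r0 k) <= l2norm s.
Proof.
move=> /gmres_affineP[b ->]; have [a [ha ->]] := gmres_residual_orthogonal T r0 k.
rewrite l2norm_le_sqr ?l2norm_ge0 // sqr_l2norm; exact: orthogonal_residual_min.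
Qed.

Lemma gmres_residual0 N (T : 'M[R[i]]_N) (r0 : 'cV[R[i]]_N) :
  l2norm (gmres_residual T r0 0) = l2norm r0.
Proof.
have [a [_ ->]] := gmres_residual_orthogonal T r0 0.
by rewrite [a]flatmx0 mulmx0 addr0.
Qed.

Lemma gmres_residual_decr N (T : 'M[R[i]]_N) (r0 : 'cV[R[i]]_N) k :
  l2norm (gmres_residual T r0 k.+1) <= l2norm (gmres_residual T r0 k).
Proof.
have [a [_ ->]] := gmres_residual_orthogonal T r0 k.
apply: gmres_residual_min; exists (krylovmx T r0 k *m a); last by rewrite mulmxA.
rewrite /= krylovmxE; apply: memv_suml => j _; apply/memvZ/memv_span.
by apply/mapP; exists (j : nat); rewrite // mem_iota /= add0n ltnS ltnW.
Qed.

(** Residual norms do not increase, so all the quotients are at most one and both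
    suprema bound the elements of their sets; the quotient for k = 1 starting from z
    is the only one needed. *)
Lemma gmres_rate_spec N (T : 'M[R[i]]_N) :
  0 <= gmres_rate T /\
  forall z, l2norm (gmres_residual T z 1) <= gmres_rate T * l2norm z.
Proof.
pose K z := [set l2norm (gmres_residual T z k) / l2norm (gmres_residual T z k.-1) |
  k in [set k | (0 < k)%N]]%classic.
have K1 z : ubound (K z) 1.
  move=> _ [[//|k] _ <-] /=.
  have [->|n0] := eqVneq (l2norm (gmres_residual T z k)) 0.
    by rewrite invr0 mulr0 ler01.
  by rewrite ler_pdivrMr ?mul1r ?gmres_residual_decr // lt_def n0 l2norm_ge0.
have hz z : l2norm (gmres_residual T z 1) / l2norm z <= gmres_rate T.
  apply: (@le_trans _ _ (sup (K z))).
    apply: ub_le_sup; first by exists 1; exact: K1.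
    by exists 1%N => //=; rewrite gmres_residual0.
  apply: ub_le_sup; last by exists z.
  exists 1 => _ [y _ <-]; apply: ge_sup; last exact: K1.
  by exists (l2norm (gmres_residual T y 1) / l2norm (gmres_residual T y 0)); exists 1%N.
have M0 : 0 <= gmres_rate T.
  by apply: le_trans (hz 0); rewrite divr_ge0 ?l2norm_ge0.
split=> // z; have [z0|z0] := eqVneq (l2norm z) 0.
  have := gmres_residual_decr T z 0; rewrite gmres_residual0 z0 mulr0.
  by [].
by rewrite -ler_pdivrMr // lt_def z0 l2norm_ge0.
Qed.

(** The distance of z from the line spanned by T z is |z| times the sine of their
    angle, so that this sine is at most the rate. *)
Lemma gmres_rate_cosine N (T : 'M[R[i]]_N) z :
  (1 - gmres_rate T ^+ 2) * (normsq z * normsq (T *m z)) <=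
    Normc.normc (vdot (T *m z) z) ^+ 2.
Proof.
have [M0 /(_ z)] := gmres_rate_spec T.
have [a [_ ->]] := gmres_residual_orthogonal T z 1.
rewrite -mulmxA krylovmxE big_ord1 expr0 mul1mx -scalemxAr.
rewrite l2norm_le_sqr ?mulr_ge0 ?l2norm_ge0 // exprMn sqr_l2norm.
set w := T *m z; set c := a 0 0; set M := gmres_rate T.
move=> h.
have h2 : normsq (z + c *: w) * normsq w <= M ^+ 2 * normsq z * normsq w.
  by rewrite ler_wpM2r ?normsq_ge0.
suff h3 : normsq z * normsq w - Normc.normc (vdot w z) ^+ 2 <= normsq (z + c *: w) * normsq w.
  by rewrite mulrBl mul1r mulrA; lra.
rewrite normsqD normsqZ vdotZr (vdotC w z) !normc_sqr.
clearbody w c; case: (vdot w z) => p q; case: c {h h2} => c1 c2 /=.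
set n := normsq w; set m := normsq z.
have : 0 <= (n * c1 + p) ^+ 2 + (n * c2 + q) ^+ 2 by rewrite addr_ge0 ?sqr_ge0.
by nra.
Qed.

(** The angle between z and B^-1 z is the angle between B y and y for y = B^-1 z, so
    [gmres_rate_cosine] for B is the hypothesis of [ideal_of_worst_case_degree1] for
    the inverse of B. The inverse is what makes |A^-1|, and not |B^-1|, appear in the
    final bound. *)
Lemma exists_uniform_multiplier N (B : 'M[R[i]]_N) (M' : R) : B \in unitmx ->
  gmres_rate B < 1 -> gmres_rate B < M' ->
  exists c : R[i], forall z, l2norm (z - c *: (invmx B *m z)) <= M' * l2norm z.
Proof.
move=> uB M1 MM'; have [M0 _] := gmres_rate_spec B; set M := gmres_rate B in M0 M1 MM' *.
have M'0 : 0 <= M' by rewrite ltW // (le_lt_trans M0).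
pose LT := frobenius_norm (invmx B) ^+ 2 + 1.
pose LB := frobenius_norm B ^+ 2 + 1.
have L0 (T : 'M[R[i]]_N) : 0 < frobenius_norm T ^+ 2 + 1.
  by rewrite ltr_wpDl ?sqr_ge0.
have hL (T : 'M[R[i]]_N) z : normsq (T *m z) <= (frobenius_norm T ^+ 2 + 1) * normsq z.
  by apply: (le_trans (normsq_mul_le T z)); rewrite ler_wpM2r ?normsq_ge0 // lerDl.
have [|||||||c hc] := @ideal_of_worst_case_degree1 R N (invmx B) (1 - M ^+ 2) LB^-1 LT
  _ _ _ _ _ _ (M' ^+ 2 - M ^+ 2).
- by rewrite subr_ge0 expr_le1 // ltW.
- by rewrite invr_gt0 L0.
- exact: L0.
- move=> z; rewrite ler_pdivrMl ?L0 //.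
  by have := hL B (invmx B *m z); rewrite mulKVmx.
- exact: hL.
- move=> z; have := gmres_rate_cosine B (invmx B *m z); rewrite mulKVmx //.
  by rewrite (mulrC (normsq z)).
- by rewrite subr_gt0 ltr_pXn2r ?nnegrE.
exists c => z; rewrite l2norm_le_sqr ?mulr_ge0 ?l2norm_ge0 // exprMn sqr_l2norm.
by apply: (le_trans (hc z)); rewrite ler_wpM2r ?normsq_ge0 //; lra.
Qed.

(** The singular vectors of C impose conditions on A^-1 x, and for x satisfying
    them the splitting (1 - c A^-1) x = E x + (w - E w), with E = 1 - c B^-1 and
    w = C A^-1 x, gives each factor. *)
Lemma gmres_residual_le_prod N (A B C : 'M[R[i]]_N) (M' : R) r0 k :
  A = B + C -> B \in unitmx -> A \in unitmx ->
  gmres_rate B < 1 -> gmres_rate B < M' ->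
  l2norm (gmres_residual A r0 k) <=
    \prod_(0 <= j < k) (M' + (1 + M') * opnorm (invmx A) * singular_value C j.+1) * l2norm r0.
Proof.
move=> AE uB uA M1 MM'; have [M0 _] := gmres_rate_spec B.
have M'0 : 0 <= M' by rewrite ltW // (le_lt_trans M0).
have [c hc] := exists_uniform_multiplier uB M1 MM'.
pose beta j := M' + (1 + M') * opnorm (invmx A) * singular_value C j.+1.
have beta0 j : 0 <= beta j.
  by rewrite addr_ge0 // !mulr_ge0 ?addr_ge0 ?opnorm_ge0 ?singular_value_ge0.
have [a [ha ->]] := gmres_residual_orthogonal A r0 k.
have beta_ge0 : 0 <= \prod_(0 <= j < k) beta j by exact: prodr_ge0.
rewrite l2norm_le_sqr; last exact: mulr_ge0 beta_ge0 (l2norm_ge0 _).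
rewrite exprMn sqr_l2norm -prodrXl.
apply: (@orthogonal_residual_le_prod R N A r0 k a c (fun j => beta j ^+ 2)) => //.
  by move=> j; exact: sqr_ge0.
move=> j jN; have [m [Z [mj hZ]]] := exists_conditions_singular_value C jN.
exists m, (Z *m invmx A); split=> // x; rewrite -mulmxA => /hZ hx.
rewrite -(sqr_l2norm x) -exprMn -l2norm_le_sqr ?mulr_ge0 ?l2norm_ge0 //.
pose w := C *m (invmx A *m x).
have -> : (1%:M - c *: invmx A) *m x =
   (x - c *: (invmx B *m x)) + (w - (w - c *: (invmx B *m w))).
  have wE : w = x - B *m (invmx A *m x).
    have CE : C = A - B by rewrite AE addrAC subrr add0r.
    by rewrite /w CE mulmxBl mulKVmx.
  rewrite mulmxBl mul1mx -scalemxAl subKr wE.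
  by rewrite mulmxBr mulKmx // scalerBr addrA subrK.
apply: (le_trans (l2normD _ _)); rewrite mulrDl lerD //.
apply: (le_trans (l2normD _ _)); rewrite l2normN.
have hw : l2norm w <= opnorm (invmx A) * singular_value C j.+1 * l2norm x.
  apply: (le_trans hx); rewrite [opnorm _ * _]mulrC -mulrA ler_wpM2l ?singular_value_ge0 //.
  exact: l2norm_mul_le_opnorm.
apply: (@le_trans _ _ ((1 + M') * l2norm w)).
  by rewrite mulrDl mul1r lerD2l.
by rewrite -!mulrA ler_wpM2l ?addr_ge0 // mulrA.
Qed.

(** * The limit M' -> M, means, and the final bounds *)

(** Removes the loss M' > M: the product is a polynomial in M'. *)
Lemma prod_affine_right_limit (q M : R) (t : nat -> R) k :
  (forall M', M < M' -> q <= \prod_(0 <= j < k) (M' + (1 + M') * t j)) ->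
  q <= \prod_(0 <= j < k) (M + (1 + M) * t j).
Proof.
move=> h; pose P : {poly R} := \prod_(0 <= j < k) ('X + (1 + 'X) * (t j)%:P).
have PE x : P.[x] = \prod_(0 <= j < k) (x + (1 + x) * t j).
  by rewrite horner_prod; apply: eq_bigr => j _; rewrite !hornerE.
rewrite -PE leNgt; apply/negP => qP.
have e0 : 0 < q - P.[M] by rewrite subr_gt0.
have [d d0 hd] := polyrcf.poly_cont M P e0.
have := h (M + d / 2); rewrite ltrDl divr_gt0 // -PE => /(_ isT) hq.
have := hd (M + d / 2); rewrite addrAC subrr add0r gtr0_norm ?divr_gt0 //.
have -> : d / 2 < d by lra.
move=> /(_ isT); rewrite ltNge => /negP; apply.
by apply: le_trans (ler_norm _); lra.
Qed.

Lemma prod_le_mean_exp (f : nat -> R) k : (0 < k)%N -> (forall j, 0 <= f j) ->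
  \prod_(0 <= j < k) f j <= ((\sum_(0 <= j < k) f j) / k%:R) ^+ k.
Proof.
move=> k0 f0; have := @leif_AGM R 'I_k predT (fun i => f i) (fun i _ => f0 i).
by rewrite card_ord !big_mkord => /leifP; case: ifP => _ => [/eqP->|/ltW].
Qed.

(** Cauchy-Schwarz against the constant sequence 1. *)
Lemma sum_le_sqrt_sum_sqr (f : nat -> R) k (F : R) : 0 <= F ->
  \sum_(0 <= j < k) f j ^+ 2 <= F ^+ 2 ->
  \sum_(0 <= j < k) f j <= Num.sqrt k%:R * F.
Proof.
move=> F0 hF; have [|s0] := leP (\sum_(0 <= j < k) f j) 0.
  by move=> /le_trans; apply; rewrite mulr_ge0 ?sqrtr_ge0.
rewrite -(@ler_pXn2r _ 2) ?nnegrE ?mulr_ge0 ?sqrtr_ge0 ?(ltW s0) //.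
rewrite exprMn sqr_sqrtr //; apply: (le_trans _ (ler_wpM2l _ hF)) => //.
(* The induction step needs 2 f k (sum of the f j) <= k (f k)^2 + sum of the (f j)^2. *)
elim: k {hF s0} => [|k IH]; first by rewrite !big_geq // expr0n mul0r.
have h n : n%:R * f k ^+ 2 + \sum_(0 <= j < n) f j ^+ 2 >= 2 * f k * \sum_(0 <= j < n) f j.
  elim: n => [|n IHn]; first by rewrite !big_geq // mulr0 mul0r addr0.
  rewrite !big_nat_recr //= -natr1 mulrDr.
  by have := sqr_ge0 (f k - f n); nra.
have hk := h k; rewrite !big_nat_recr //= -natr1; move: IH hk.
set S := \sum_(0 <= i < k) f i; set Q := \sum_(0 <= i < k) f i ^+ 2.
by nra.
Qed.

End Gmres.

Theorem corollary1p2 (R : realType) (N : nat) (hN : (0 < N)%N)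
    (A B C : 'M[R[i]]_N) (hA : A = B + C)
    (hBu : B \in unitmx) (hAu : A \in unitmx) (hM : gmres_rate B < 1)
    (r0 : 'cV[R[i]]_N) :
  (forall k : nat, (0 < k)%N ->
     l2norm (gmres_residual A r0 k) / l2norm r0 <=
     \prod_(1 <= j < k.+1)
       (gmres_rate B +
        (1 + gmres_rate B) * opnorm (invmx A) * singular_value C j)) /\
  (forall k : nat, (0 < k)%N ->
     (l2norm (gmres_residual A r0 k) / l2norm r0) `^ (k%:R^-1) <=
     gmres_rate B +
     (Num.sqrt k%:R)^-1 * (1 + gmres_rate B) * opnorm (invmx A) *
       frobenius_norm C).
Proof.
have [M0 _] := gmres_rate_spec B; set M := gmres_rate B in M0 hM *.
pose a := opnorm (invmx A); pose s j := singular_value C j.+1.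
have a0 : 0 <= a by exact: opnorm_ge0.
pose beta j := M + (1 + M) * (a * s j).
have beta0 j : 0 <= beta j.
  by rewrite addr_ge0 // !mulr_ge0 ?addr_ge0 ?singular_value_ge0.
have product_bound k : l2norm (gmres_residual A r0 k) / l2norm r0 <= \prod_(0 <= j < k) beta j.
  have [->|n0] := eqVneq (l2norm r0) 0; first by rewrite invr0 mulr0 prodr_ge0.
  have r0p : 0 < l2norm r0 by rewrite lt_def n0 l2norm_ge0.
  apply: prod_affine_right_limit => M' MM'; rewrite ler_pdivrMr //.
  apply: (le_trans (gmres_residual_le_prod r0 k hA hBu hAu hM MM')).
  by rewrite ler_wpM2r ?l2norm_ge0 //; under eq_bigr do rewrite -mulrA.
split=> k k0.
  by rewrite big_add1 /=; under eq_bigr do rewrite -mulrA; exact: product_bound.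
pose m := (\sum_(0 <= j < k) beta j) / k%:R.
have m0 : 0 <= m by rewrite divr_ge0 // sumr_ge0.
have kp : 0 < k%:R :> R by rewrite ltr0n.
have q0 : 0 <= l2norm (gmres_residual A r0 k) / l2norm r0.
  by rewrite divr_ge0 ?l2norm_ge0.
apply: (@le_trans _ _ m).
  have -> : m = (m ^+ k) `^ k%:R^-1.
    by rewrite -powR_mulrn // -powRrM mulfV ?gt_eqF // powRr1.
  apply: ge0_ler_powR; rewrite ?nnegrE ?invr_ge0 ?exprn_ge0 //.
  exact: le_trans (product_bound k) (prod_le_mean_exp k0 beta0).
have -> : m = M + (1 + M) * a * ((\sum_(0 <= j < k) s j) / k%:R).
  rewrite /m /beta big_split /= sumr_const_nat subn0 -mulr_sumr -mulr_sumr.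
  by rewrite -mulr_natr; field; rewrite gt_eqF.
rewrite lerD2l.
have -> : (Num.sqrt k%:R)^-1 * (1 + M) * opnorm (invmx A) * frobenius_norm C =
  (1 + M) * a * (frobenius_norm C / Num.sqrt k%:R).
  by rewrite -/a; ring.
apply: ler_wpM2l; first by rewrite mulr_ge0 ?addr_ge0.
have sp : 0 < Num.sqrt k%:R :> R by rewrite sqrtr_gt0.
rewrite ler_pdivrMr //.
have -> : frobenius_norm C / Num.sqrt k%:R * k%:R = Num.sqrt k%:R * frobenius_norm C.
  rewrite -{2}(@sqr_sqrtr _ k%:R) //; first by field; rewrite gt_eqF.
apply: sum_le_sqrt_sum_sqr; first exact: sqrtr_ge0.
exact: sum_sqr_singular_value.
Qed.
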